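(* Let $I$ be a simple complete monomial ideal in $R$ of order $r$, with $r\ge 2$, written as $I=\langle x^{a_i}y^{b_i}\mid 0\le i\le r\rangle$ with $a_0>a_1>\dots>a_{r-1}>a_r=0$, $b_0=0<b_1<\dots<b_{r-1}<b_r$ and $a_0\le b_r$. Then for any $2\le e\le r$, the associated module $M=M(I;e)$ is an indecomposable integrally closed $R$-module of rank $e$ with $I(M)=I$.
   Context: $(R,\mathfrak m)$ is a two-dimensional regular local ring with infinite residue field, and $x,y$ is a fixed regular system of parameters, $\mathfrak m=\langle x,y\rangle$; monomial ideals are with respect to $x,y$. An ideal is complete if it is integrally closed, and simple if it cannot be expressed as a product of two proper ideals. The order of an ideal $\mathfrak a$ is $\operatorname{ord}(\mathfrak a)=\max\{n\mid\mathfrak a\subset\mathfrak m^n\}$. The module $M(I;e)$: for $I$ written as in the claim and $2\le e\le r$, put $a_i'=a_i-e+1$ for $0\le i\le r-e+1$ and $c_i=b_{r-e+1+i}-i$ for $1\le i\le e-1$. Let $\epsilon_1,\dots,\epsilon_e$ be the standard basis of $R^e$. Then $M(I;e)\subset F:=R^e$ is the submodule generated by $f_i=x^{a_i'}y^{b_i}\epsilon_1$ for $0\le i\le r-e+1$, $g_i=y\,\epsilon_i+x\,\epsilon_{i+1}$ for $1\le i\le e-1$, $h_i=y^{c_i}\epsilon_{i+1}$ for $1\le i\le e-1$. For a finitely generated torsion-free $R$-module $M$, the double dual $M^{**}$ is free and contains $M$ with finite-length quotient; $I(M)=\operatorname{Fitt}_0(M^{**}/M)$. (For $M=M(I;e)$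 one has $M^{**}=R^e$, so $I(M)$ is the ideal generated by the maximal minors of the matrix whose columns are $f_0,\dots,f_{r-e+1},g_1,\dots,g_{e-1},h_1,\dots,h_{e-1}$.) Integral closure of modules (Rees): with $K$ the fraction field of $R$, $M_K=M\otimes_R K$, and $MV$ the image of $M\otimes_R V\to M_K$ for $R\subset V\subset K$, set $\overline M=\{f\in M_K\mid f\in MV$ for every discrete valuation ring $V$ with $R\subset V\subset K\}$; $M$ is integrally closed if $\overline M=M$. *)

(* Defs.v *)
From mathcomp Require Import all_boot all_algebra.
From mathcomp Require Import all_classical.

Set Implicit Arguments.
Unset Strict Implicit.
Unset Printing Implicit Defensive.
Import GRing.Theory.
Local Open Scope classical_set_scope.
Local Open Scope ring_scope.

Section Submodules.
Variables (R : nzRingType) (V : lmodType R).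

Definition submodule (A : set V) : Prop := submod_closed [in A].

Definition submod_span (S : set V) : set V := smallest submodule S.

Definition indecomposable (M : set V) : Prop :=
  M <> [set 0] /\
  forall M1 M2 : set V, submodule M1 -> submodule M2 ->
    M = [set u + v | u in M1 & v in M2] -> M1 `&` M2 = [set 0] ->
    M1 = [set 0] \/ M2 = [set 0].

End Submodules.

Section Ideals.
Variable R : comNzRingType.
Implicit Types I J P m : set R.

Definition ideal J : Prop := submodule (J : set R^o).

(** The library's [idealr_closed] includes [1 \notin J]. *)
Definition is_proper_ideal J : Prop := idealr_closed [in J].

Definition ideal_gen (S : set R) : set R := submod_span (S : set R^o).

Definition ideal_mul I J : set R := ideal_gen [set u * v | u in I & v in J].

Definition ideal_pow I (n : nat) : set R := iter n (ideal_mul I) [set: R].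

Definition maximal_ideal m : Prop :=
  is_proper_ideal m /\ forall J, is_proper_ideal J -> m `<=` J -> J = m.

(** [m] is the unique maximal ideal of [R]. *)
Definition local_with m : Prop := forall J, maximal_ideal J <-> J = m.

Definition prime_ideal P : Prop :=
  is_proper_ideal P /\ prime_idealr_closed [in P].

Definition simple_ideal I : Prop :=
  ideal I /\
  forall J1 J2, is_proper_ideal J1 -> is_proper_ideal J2 -> I <> ideal_mul J1 J2.

Definition integral_over_ideal I (z : R) : Prop :=
  exists (n : nat) (c : nat -> R),
    [/\ (0 < n)%N,
        forall i, (1 <= i <= n)%N -> ideal_pow I i (c i)
      & z ^+ n + \sum_(1 <= i < n.+1) c i * z ^+ (n - i) = 0].

Definition complete_ideal I : Prop :=
  ideal I /\ forall z, integral_over_ideal I z -> I z.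

(** [ord I = r] in the local ring with maximal ideal [m]. *)
Definition ideal_order m I (r : nat) : Prop :=
  I `<=` ideal_pow m r /\ forall n, I `<=` ideal_pow m n -> (n <= r)%N.

(** The residue field [R / m], as the set of cosets of [m]. *)
Definition infinite_residue_field m : Prop :=
  infinite_set (range (fun u : R => [set w | m (w - u)])).

End Ideals.

Definition noetherian (R : comNzRingType) : Prop :=
  forall J : set R, ideal J -> exists s : seq R, J = ideal_gen [set` s].

Definition prime_chain (R : comNzRingType) (n : nat) : Prop :=
  exists p : nat -> set R,
    (forall i, (i <= n)%N -> prime_ideal (p i)) /\
    (forall i, (i < n)%N -> p i `<` p i.+1).

Definition krull_dim (R : comNzRingType) (d : nat) : Prop :=
  prime_chain R d /\ ~ prime_chain R d.+1.

(** [x, y] is a regular system of parameters of the two-dimensional regular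
    local ring [R] with maximal ideal [m]. *)
Definition regular_local2 (R : comNzRingType) (m : set R) (x y : R) : Prop :=
  [/\ noetherian R, local_with m, krull_dim R 2 & m = ideal_gen [set x; y]].

Section FittingDual.
Variable R : comNzRingType.

(** [Hom_R(M, R)]: an [R]-linear map on [M] is represented by its extension by
    zero to the ambient module [V]. *)
Definition dual_module (V : lmodType R) (M : set V) : set (V -> R^o) :=
  [set phi | (forall a u v, M u -> M v ->
                phi (a *: u + v) = a *: phi u + phi v) /\
             (forall v, ~ M v -> phi v = 0)].

(** The canonical map from [M] to its double dual. *)
Definition bidual_map (V : lmodType R) (M : set V) (v : V) :
    (V -> R^o) -> R^o :=
  fun phi => if phi \in dual_module M then phi v else 0.

(** [Fitt_0 (N / N')], for [N / N'] finitely generated: the ideal generated by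
    the determinants of the [n] x [n] matrices of relations between the classes
    of [n] generators [q]. By Fitting's lemma this ideal is the same for all
    choices of [n] and [q]. *)
Definition fitt0 (W : lmodType R) (N N' : set W) : set R :=
  [set z | exists (n : nat) (q : 'I_n -> W),
     [/\ forall i, N (q i),
         forall w, N w -> exists c : 'I_n -> R, N' (w - \sum_i c i *: q i)
       & ideal_gen [set \det A | A in
           [set A : 'M[R]_n | forall i, N' (\sum_j A i j *: q j)]] z]].

Definition fitting_ideal (V : lmodType R) (M : set V) : set R :=
  fitt0 (dual_module (dual_module M)) (bidual_map M @` M).

End FittingDual.

(** Submodules [M] of the free module [R^n]; then [M_K], [MV] and the integral
    closure live in [K^n], where [K = {fraction R}]. *)
Section IntegralClosure.
Variable R : idomainType.
Local Notation K := {fraction R}.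

Definition fracv (n : nat) (v : 'cV[R]_n) : 'cV[K]_n :=
  map_mx (@tofrac R) v.

Definition module_frac (n : nat) (M : set 'cV[R]_n) : set 'cV[K]_n :=
  submod_span (@fracv n @` M).

Definition module_rank (n : nat) (M : set 'cV[R]_n) (d : nat) : Prop :=
  exists U : {vspace 'cV[K]_n}, module_frac M = [set` U] /\ \dim U = d.

(** Discrete valuations of [K]; the value of [v] at [0] is irrelevant. *)
Definition discrete_valuation (v : K -> int) : Prop :=
  [/\ forall f g, f != 0 -> g != 0 -> v (f * g) = v f + v g,
      forall f g, f != 0 -> g != 0 -> f + g != 0 ->
        Num.min (v f) (v g) <= v (f + g)
    & forall k : int, exists2 f, f != 0 & v f = k].

Definition dvr (V : set K) : Prop :=
  exists2 v, discrete_valuation v & V = [set f | f = 0 \/ 0 <= v f].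

(** [MV], the [V]-submodule of [K^n] generated by [M]. *)
Definition extend_module (n : nat) (V : set K) (M : set 'cV[R]_n) :
    set 'cV[K]_n :=
  smallest [set A | A 0 /\
              forall a u w, V a -> A u -> A w -> A (a *: u + w)]
           (@fracv n @` M).

Definition integral_closure (n : nat) (M : set 'cV[R]_n) : set 'cV[K]_n :=
  [set f | module_frac M f /\
     forall V : set K, dvr V -> range (@tofrac R) `<=` V ->
       extend_module V M f].

Definition integrally_closed (n : nat) (M : set 'cV[R]_n) : Prop :=
  integral_closure M = @fracv n @` M.

End IntegralClosure.

Section AssociatedModule.
Variables (R : comNzRingType) (x y : R).

(** The standard basis of [R^e], numbered from [1] to [e]. *)
Definition eps (e i : nat) : 'cV[R]_e := \col_(k < e) (k.+1 == i)%:R.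

(** In the intended range [e <= r] and [a], [b] strictly monotone on [0 .. r],
    so none of the truncated subtractions truncates. *)
Definition assoc_module (r : nat) (a b : nat -> nat) (e : nat) :
    set 'cV[R]_e :=
  let a' i := (a i + 1 - e)%N in
  let c i := (b (r - e + 1 + i) - i)%N in
  submod_span (
    [set (x ^+ a' i * y ^+ b i) *: eps e 1
       | i in [set i | (i <= r - e + 1)%N]] `|`
    [set y *: eps e i + x *: eps e i.+1
       | i in [set i | (1 <= i <= e - 1)%N]] `|`
    [set y ^+ c i *: eps e i.+1
       | i in [set i | (1 <= i <= e - 1)%N]]).

End AssociatedModule.

Arguments assoc_module {R} x y r a b e.

(* Main.v *)
Require Import Defs.
From mathcomp Require Import all_boot all_order all_algebra.
From mathcomp Require Import all_classical.
From mathcomp Require Import perm zify ring.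

Set Implicit Arguments.
Unset Strict Implicit.
Unset Printing Implicit Defensive.
Import Order.POrderTheory GRing.Theory Num.Theory.
Local Open Scope classical_set_scope.
Local Open Scope ring_scope.


(** Write [q] for [b r] and number the coordinates of [R^e] from [0].

    The shape of [I]. If an interior generator of [I] lies on or below the segment
    joining [(a 0, 0)] to [(0, q)], then cutting the Newton polygon of [I] at such
    a generator of least weight writes [I] as a product ([complete_split]). So [I]
    being simple forces all of them above the segment; its order being [r] then
    forces [a i = r - i], and [q] and [r] are coprime because the segment has no
    interior lattice point. As [I] is complete, it consists of all [z] with
    [v z >= q * r], where [v] is the monomial valuation with [v x = q] and
    [v y = r] ([staircase_wt]).

    The module. The linear form [Phi f = sum_k (- y)^k x^(e - 1 - k) f_k]
    ([minor_form]) has the span of the [g_i] as kernel and maps the [f_i] and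
    [h_i], up to sign, onto the monomial generators of [I]; hence [M] is the
    preimage of [I] under [Phi] ([assoc_moduleE]), and all four claims are read
    off from this.

    - Rank: [x^r] multiplies [R^e] into [M].
    - Integral closedness: an integral vector has its coordinates in all discrete
      valuation rings between [R] and its fraction field, so in [R]
      ([in_all_dvr]); and [Phi] maps it to an element of value at least [q * r].
    - Indecomposability: the projection onto a direct summand extends to an
      idempotent matrix [P] over [R]. Since [P g_i] is in [M], the linear parts show
      that [P] is upper triangular with constant diagonal modulo [m], and an
      idempotent of this kind over a local ring is [0] or [1].
    - Fitting ideal: [M] has double dual [R^e] ([bidual_eval]). Every [z] in [I] is
      [Phi w] for some [w] in [M], and this is the determinant of [w, g_1, .., g_(e-1)].
      Conversely a determinant of relations has value at least [q * r], as one
      sees by replacing one of its columns by a column of values of [Phi]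
      ([relation_det]).

    The facts about [R] that this needs are proved from its definition: [x, y] is
    a regular sequence ([regular_seq_xy]), so monomials are independent modulo [m]
    ([monomial_indep]); the weight filtrations are the order filtrations of
    valuations ([wt_filtration]); and primes other than [0] and [m] are principal
    ([prime_principal]), which yields the [f]-adic valuations behind
    [in_all_dvr]. *)

(** * Submodules and ideals *)

Lemma ex_least (Q : nat -> Prop) : (exists n, Q n) ->
  exists n, Q n /\ forall k, Q k -> (n <= k)%N.
Proof.
move=> [n Qn]; have ex : exists j, `[< Q j >] by exists n; apply/asboolP.
exists (ex_minn ex); case: ex_minnP => j /asboolP Qj jmin; split=> // k Qk.
by apply: jmin; apply/asboolP.
Qed.

Lemma submoduleP (R : nzRingType) (V : lmodType R) (A : set V) :
  submodule A <-> A 0 /\ forall c u v, A u -> A v -> A (c *: u + v).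
Proof.
split=> -[A0 Alin]; split.
- by have := A0; rewrite inE.
- by move=> c u v Au Av; have := Alin c u v; rewrite !inE; apply.
- by rewrite inE.
- by move=> c u v; rewrite !inE; apply: Alin.
Qed.

Section SubmoduleTheory.
Variables (R : nzRingType) (V : lmodType R).
Implicit Types (A S : set V).

Lemma submodule0 A : submodule A -> A 0.
Proof. by move=> /submoduleP[]. Qed.

Lemma submoduleZ A c u : submodule A -> A u -> A (c *: u).
Proof. by move=> /submoduleP[A0 Al] Au; rewrite -[_ *: _]addr0; apply: Al. Qed.

Lemma submoduleD A u v : submodule A -> A u -> A v -> A (u + v).
Proof. by move=> /submoduleP[A0 Al] Au Av; rewrite -[u]scale1r; apply: Al. Qed.

Lemma submoduleN A u : submodule A -> A u -> A (- u).
Proof. by move=> Am Au; rewrite -scaleN1r; apply: submoduleZ. Qed.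

Lemma submoduleB A u v : submodule A -> A u -> A v -> A (u - v).
Proof. by move=> Am Au Av; apply: submoduleD => //; apply: submoduleN. Qed.

Lemma submodule_sum A (I : Type) (s : seq I) (P : pred I) (F : I -> V) :
  submodule A -> (forall i, P i -> A (F i)) -> A (\sum_(i <- s | P i) F i).
Proof.
move=> Am AF; elim/big_ind: _ => //; first exact: submodule0.
by move=> u v; apply: submoduleD.
Qed.

Lemma submod_span_submodule S : submodule (submod_span S).
Proof.
apply/submoduleP; split=> [A [Am _]|c u v Su Sv A [Am SA]].
  exact: submodule0.
by apply: submoduleD => //; [apply: submoduleZ => //; apply: Su|apply: Sv].
Qed.

Lemma submod_span_gen S : S `<=` submod_span S.
Proof. by move=> u Su A [_]; apply. Qed.

Lemma submod_span_sub S A : submodule A -> S `<=` A -> submod_span S `<=` A.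
Proof. by move=> Am SA u; apply. Qed.

End SubmoduleTheory.

Section IdealTheory.
Variable R : comNzRingType.
Implicit Types (J S : set R) (c z w : R).

Lemma idealP J : ideal J <-> J 0 /\ forall c u v, J u -> J v -> J (c * u + v).
Proof. exact: submoduleP. Qed.

Lemma ideal0 J : ideal J -> J 0. Proof. exact: submodule0. Qed.

Lemma idealM J c z : ideal J -> J z -> J (c * z).
Proof. exact: submoduleZ. Qed.

Lemma idealD J z w : ideal J -> J z -> J w -> J (z + w).
Proof. exact: submoduleD. Qed.

Lemma idealN J z : ideal J -> J z -> J (- z).
Proof. exact: submoduleN. Qed.

Lemma idealB J z w : ideal J -> J z -> J w -> J (z - w).
Proof. exact: submoduleB. Qed.

Lemma ideal_sum J (I : Type) (s : seq I) (P : pred I) (F : I -> R) :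
  ideal J -> (forall i, P i -> J (F i)) -> J (\sum_(i <- s | P i) F i).
Proof. exact: submodule_sum. Qed.

Lemma ideal_gen_ideal S : ideal (ideal_gen S).
Proof. exact: submod_span_submodule. Qed.

Lemma ideal_gen_gen S : S `<=` ideal_gen S.
Proof. exact: (@submod_span_gen R R^o). Qed.

Lemma ideal_gen_sub S J : ideal J -> S `<=` J -> ideal_gen S `<=` J.
Proof. exact: (@submod_span_sub R R^o). Qed.

Lemma ideal_setT : ideal [set: R].
Proof. by apply: (proj2 (idealP [set: R])); split. Qed.

Lemma proper_idealP J : is_proper_ideal J <-> ideal J /\ ~ J 1.
Proof.
split=> [[J0 J1 Jl]|[/idealP[J0 Jl] J1]].
  split; last by move=> J1'; move/negP: J1; apply; rewrite inE.
  apply/idealP; split; first by move: J0; rewrite inE.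
  by move=> c u v Ju Jv; have := Jl c u v; rewrite !inE; apply.
split; first by rewrite inE.
  by apply/negP; rewrite inE.
by move=> c u v; rewrite !inE; apply: Jl.
Qed.

Lemma prime_idealP (P : set R) : prime_ideal P <->
  [/\ ideal P, ~ P 1 & forall u v, P (u * v) -> P u \/ P v].
Proof.
split=> [[/proper_idealP[Pi P1] Pp]|[Pi P1 Pp]].
  split=> // u v Puv; have := Pp u v; rewrite !inE => /(_ Puv) /orP[].
    by rewrite inE; left.
  by rewrite inE; right.
split; first exact/proper_idealP.
move=> u v; rewrite !inE => /Pp[Pu|Pv]; apply/orP; rewrite !inE; tauto.
Qed.

Definition ideal_adjoin J z : set R := [set w | exists2 u, J u & exists c, w = u + c * z].

Lemma ideal_adjoin_ideal J z : ideal J -> ideal (ideal_adjoin J z).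
Proof.
move=> Ji; apply/idealP; split.
  by exists 0; [exact: ideal0 | exists 0; ring].
move=> c _ _ [u Ju [d ->]] [u' Ju' [d' ->]].
exists (c * u + u'); first by apply: idealD => //; apply: idealM.
by exists (c * d + d'); ring.
Qed.

Lemma ideal_adjoin_sub J z : J `<=` ideal_adjoin J z.
Proof. by move=> u Ju; exists u => //; exists 0; ring. Qed.

Lemma ideal_adjoin_gen J z : ideal J -> ideal_adjoin J z z.
Proof. by move=> Ji; exists 0; [exact: ideal0 | exists 1; ring]. Qed.

Definition principal z : set R := [set w | exists c, w = c * z].

Lemma principal_ideal z : ideal (principal z).
Proof.
apply/idealP; split; first by exists 0; ring.
by move=> c _ _ [d ->] [d' ->]; exists (c * d + d'); ring.
Qed.

Lemma principal_self z : principal z z.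
Proof. by exists 1; ring. Qed.

Definition colon J z : set R := [set w | J (w * z)].

Lemma colon_ideal J z : ideal J -> ideal (colon J z).
Proof.
move=> Ji; apply/idealP; split; first by rewrite /colon /= mul0r; exact: ideal0.
move=> c u v; rewrite /colon /= => Ju Jv.
by rewrite mulrDl -mulrA; apply: idealD => //; apply: idealM.
Qed.

End IdealTheory.

(** * Noetherian rings *)

Section Noetherian.
Variable R : comNzRingType.
Hypothesis noethR : noetherian R.

(** A totally ordered family of ideals has a finitely generated union, so the
    union is a member of the family, and Zorn's lemma applies. *)
Lemma noetherian_max (F : set (set R)) : F `<=` @ideal R -> F !=set0 ->
  exists2 J, F J & forall J', F J' -> J `<=` J' -> J' `<=` J.
Proof.
move=> Fi [J0 FJ0].
have [G Gsub Gtot|A [PA Amax]] := @Zorn_bigcup R (fun A => A = set0 \/ F A).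
  have [[X GX [z Xz]]|Gne] := pselect (exists2 X, G X & X !=set0); last first.
    left; rewrite -subset0 => z [X GX Xz]; apply: Gne.
    by exists X => //; exists z.
  have GF Y w : G Y -> Y w -> F Y by move=> /Gsub [->|].
  have GI Y w : G Y -> Y w -> ideal Y by move=> GY Yw; apply: Fi; apply: GF Yw.
  set U := \bigcup_(Y in G) Y.
  have Uideal : ideal U.
    apply/idealP; split; first by exists X => //; apply: ideal0; apply: GI Xz.
    move=> c u v [Y GY Yu] [Y' GY' Yv].
    have [YY|YY] := Gtot _ _ GY GY'.
      exists Y' => //; apply: idealD => //; first exact: GI Yv.
      by apply: idealM; [exact: GI Yv | exact: YY].
    exists Y => //; apply: idealD; [exact: GI Yu | | exact: YY].
    by apply: idealM; [exact: GI Yu |].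
  have [s Us] := noethR Uideal.
  have sU w : w \in s -> U w by move=> ws; rewrite Us; apply: ideal_gen_gen.
  have [Y [GY FY Ys]] : exists Y, [/\ G Y, F Y & forall w, w \in s -> Y w].
    elim: s {Us} sU => [|w s IHs] sU; first by exists X; split=> //; exact: (GF _ z).
    have [w' ws'|Y [GY FY Ys]] := IHs; first by apply: sU; rewrite inE ws' orbT.
    have [Y' GY' Yw] : U w by apply: sU; rewrite mem_head.
    have [YY|YY] := Gtot _ _ GY GY'.
      exists Y'; split=> //; first exact: (GF _ w).
      by move=> w'; rewrite inE => /predU1P[->//|/Ys /YY].
    exists Y; split=> // w'; rewrite inE => /predU1P[->|/Ys//]; exact: YY.
  right; suff -> : U = Y by [].
  apply/seteqP; split=> [w|w Yw]; last by exists Y.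
  by rewrite Us; apply: ideal_gen_sub; [exact: Fi|].
case: PA => [A0|FA].
  have AJ0 : A `<` J0.
    by split; [rewrite A0 | move=> /(_ 0); rewrite A0; apply; apply: ideal0; apply: Fi].
  by case: (Amax _ AJ0); right.
exists A => // J FJ AJ; apply: contrapT => JA.
have AltJ : A `<` J by [].
by case: (Amax _ AltJ); right.
Qed.

Lemma noetherian_chain (J : nat -> set R) :
  (forall n, ideal (J n)) -> (forall n, J n `<=` J n.+1) ->
  exists N, forall n, J n `<=` J N.
Proof.
move=> Ji Jinc.
have Jmono n k : J n `<=` J (n + k)%N.
  by elim: k => [|k IHk]; rewrite ?addn0 // addnS; apply: subset_trans IHk _.
have [_ [n _ <-]//||_ [N _ <-] Nmax] := @noetherian_max (range J).
  by exists (J 0%N); exists 0%N.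
exists N => n; apply: subset_trans (Nmax (J (n + N)%N) _ _) => //.
- by rewrite addnC.
Qed.

End Noetherian.

(** * Two-dimensional regular local rings *)

Lemma regular_local2_sym (R : comNzRingType) (m : set R) (x y : R) :
  regular_local2 m x y -> regular_local2 m y x.
Proof. by case=> noethR loc dim mE; split=> //; rewrite mE setUC. Qed.

Section LocalRing.
Variables (R : idomainType) (m : set R) (x y : R).
Hypothesis hR : regular_local2 m x y.
Implicit Types (J : set R) (c z w f g : R).

Let noethR : noetherian R. Proof. by case: hR. Qed.

Lemma lmax_proper : is_proper_ideal m.
Proof. by case: hR => _ /(_ m)[_ /(_ erefl)[]]. Qed.

Lemma lmax_ideal : ideal m.
Proof. by have /proper_idealP[] := lmax_proper. Qed.

Lemma lmax1 : ~ m 1.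
Proof. by have /proper_idealP[] := lmax_proper. Qed.

Lemma lmaxP z : m z <-> exists s t, z = s * x + t * y.
Proof.
have -> : m = ideal_gen [set x; y] by case: hR.
have Gi := ideal_gen_ideal [set x; y].
have GG := @ideal_gen_gen _ [set x; y].
split=> [|[s [t ->]]]; last first.
  by apply: (idealD Gi); apply: (idealM _ Gi); apply: GG; [left|right].
set J := [set z | exists s t, z = s * x + t * y].
apply: (@ideal_gen_sub _ _ J) => [|_ [->|->]].
- apply/idealP; split; first by exists 0, 0; ring.
  move=> c _ _ [s [t ->]] [s' [t' ->]].
  by exists (c * s + s'), (c * t + t'); ring.
- by exists 1, 0; ring.
- by exists 0, 1; ring.
Qed.

Lemma lmax_x : m x.
Proof. by apply/lmaxP; exists 1, 0; ring. Qed.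

Lemma lmax_y : m y.
Proof. by apply/lmaxP; exists 0, 1; ring. Qed.

(** A proper ideal lies in a maximal one, hence in [m]. *)
Lemma proper_ideal_sub_lmax J : ideal J -> ~ J 1 -> J `<=` m.
Proof.
move=> Ji J1.
have [|| A [/proper_idealP[Ai A1] JA] Amax] := @noetherian_max _ noethR
  [set A | is_proper_ideal A /\ J `<=` A].
- by move=> A [/proper_idealP[]].
- by exists J; split=> //; apply/proper_idealP.
suff <- : A = m by [].
case: hR => _ /(_ A)[+ _] _ _; apply; split; first exact/proper_idealP.
move=> B Bp AB; apply/seteqP; split=> //; apply: Amax => //; split=> //.
exact: subset_trans AB.
Qed.

Lemma notin_lmax_unit z : ~ m z -> exists w, w * z = 1.
Proof.
move=> mz; apply: contrapT => nu; apply: mz.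
apply: (@proper_ideal_sub_lmax (principal z)); first exact: principal_ideal.
  by move=> [c c1]; apply: nu; exists c.
exact: principal_self.
Qed.

Lemma lmax_prime z w : m (z * w) -> m z \/ m w.
Proof.
move=> mzw; have [|/notin_lmax_unit[u uz]] := pselect (m z); first by left.
by right; rewrite -[w]mul1r -uz -mulrA; apply: idealM => //; exact: lmax_ideal.
Qed.

(** The hypothesis says that [J] contains [(1 - t * z) * w], and [1 - t * z] is a
    unit. *)
Lemma lmax_cancel J z t w : ideal J -> m z -> J (w - t * z * w) -> J w.
Proof.
move=> Ji mz Jw; have [|u u1] := @notin_lmax_unit (1 - t * z).
  move=> m1; apply: lmax1; rewrite -[1](subrK (t * z)).
  by apply: idealD => //; [exact: lmax_ideal | apply: idealM => //; exact: lmax_ideal].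
have -> : w = u * (w - t * z * w).
  by transitivity (u * (1 - t * z) * w); [rewrite u1; ring | ring].
exact: idealM.
Qed.

(** Nakayama's lemma. Among the ideals containing [N] but not [J] take a maximal
    one [A]; some [v] in [J] has [z * v] outside [A], so [A + (z * v)] contains
    [v], and then [A] contains a unit multiple of [v]. *)
Lemma nakayama J N z : ideal J -> ideal N -> m z ->
  (forall u, J u -> exists2 n, N n & exists2 v, J v & u = n + z * v) -> J `<=` N.
Proof.
move=> Ji Ni mz JNz; apply: contrapT => nJN.
have [A [Ai NA _]||A [Ai NA JA] Amax] := @noetherian_max _ noethR
  [set A | [/\ ideal A, N `<=` A & ~ J `<=` A]] => //; first by exists N; split.
have [v Jv Azv] : exists2 v, J v & ~ A (z * v).
  apply: contrapT => nv; apply: JA => u /JNz[n Nn [v Jv ->]].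
  apply: idealD => //; first exact: NA.
  by apply: contrapT => Azv; apply: nv; exists v.
have JA' : J `<=` ideal_adjoin A (z * v).
  apply: contrapT => nJ; apply: Azv.
  apply: (Amax (ideal_adjoin A (z * v))); last exact: ideal_adjoin_gen.
    split=> //; first exact: ideal_adjoin_ideal.
    by apply: subset_trans NA _; apply: ideal_adjoin_sub.
  exact: ideal_adjoin_sub.
have [a Aa [c vE]] := JA' v Jv.
apply: Azv; apply: idealM => //; apply: (@lmax_cancel A z c) => //.
by rewrite {1}vE -mulrA addrK.
Qed.

(** The maximal ideal of [R / x] is generated by [y]: divide by [y] as long as the
    quotient is not a unit. *)
Lemma expand_mod_x n z :
  (exists u k t, [/\ (k < n)%N, exists w, w * u = 1 & z = u * y ^+ k + t * x])
  \/ (exists c t, z = c * y ^+ n + t * x).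
Proof.
elim: n => [|n [[u [k [t [kn uU zE]]]]|[c [t zE]]]].
- by right; exists z, 0; ring.
- by left; exists u, k, t; split=> //; apply: ltnW.
have [/lmaxP[s [s' cE]]|/notin_lmax_unit cU] := pselect (m c).
  by right; exists s', (s * y ^+ n + t); rewrite zE cE exprS; ring.
by left; exists c, n, t.
Qed.

Section Prime.
Variables (p : set R) (f0 : R).
Hypotheses (pp : prime_ideal p) (pf0 : p f0) (f0_neq0 : f0 != 0).
Hypothesis (px : ~ p x).

Let fpow n : set R := [set z | exists s t, ~ p s /\ s * z = t * f0 ^+ n].

Let p_ideal : ideal p. Proof. by case/prime_idealP: pp. Qed.
Let p1 : ~ p 1. Proof. by case/prime_idealP: pp. Qed.
Let pM u v : ~ p u -> ~ p v -> ~ p (u * v).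
Proof. by case/prime_idealP: pp => _ _ pM pu pv /pM[]. Qed.

Let fpow_ideal n : ideal (fpow n).
Proof.
apply/idealP; split; first by exists 1, 0; split=> //; ring.
move=> c u v [s [t [ps su]]] [s' [t' [ps' sv]]].
exists (s * s'), (c * s' * t + s * t'); split; first exact: pM.
transitivity (c * s' * (s * u) + s * (s' * v)); first ring.
by rewrite su sv; ring.
Qed.

(** Krull's principal ideal theorem for [x]: no power of [y] is a multiple of
    [x]. Otherwise the ideals containing [x] are the finitely many
    [(x, y^k)], so [q_n + (x)] is stationary, where [q_n] is the contraction of
    the power [f0^n] from the localization at [p]; as [x] is outside [p] this
    gives [q_n = q_n.+1 + x q_n], hence [q_n = q_n.+1] and [f0] would be a unit
    of the localization. *)
Lemma pow_y_notin_x n c : y ^+ n <> c * x.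
Proof.
move=> ynx.
have fpow_dec k : fpow k.+1 `<=` fpow k.
  by move=> z [s [t [ps sz]]]; exists s, (t * f0); rewrite sz exprS mulrA.
pose hits k j := fpow k `&` [set z | exists t, z = y ^+ j + t * x] !=set0.
have hitn k : hits k n.
  by exists 0; split; [exact: ideal0 | exists (- c); rewrite ynx; ring].
(* The increasing bounded sequence [d] of the least exponents [j] with [y^j] in
   [q_k + (x)] takes the same value twice. *)
have [d dhit dmin] : exists2 d : nat -> nat, forall k, hits k (d k) &
    forall k j, hits k j -> (d k <= j)%N.
  have /choice[d dP] k : exists j, hits k j /\ forall i, hits k i -> (j <= i)%N.
    by apply: ex_least; exists n.
  by exists d => k; [case: (dP k) | case: (dP k)].
have dn k : (d k <= n)%N by apply: dmin.
have d_inc k : (d k <= d k.+1)%N.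
  by apply: dmin; have [z [/fpow_dec qz zE]] := dhit k.+1; exists z.
have [k dk] : exists k, d k = d k.+1.
  apply: contrapT => nk.
  have dlt k : (d k < d k.+1)%N.
    by rewrite ltn_neqAle d_inc andbT; apply/eqP => E; apply: nk; exists k.
  have dge : forall k, (k <= d k)%N.
    by elim=> // k IHk; apply: leq_ltn_trans IHk (dlt k).
  by have := leq_trans (dge n.+1) (dn n.+1); rewrite ltnn.
have qsub : fpow k `<=` fpow k.+1.
  apply: (@nakayama _ _ x) => //; first exact: lmax_x.
  move=> z qz.
  have [w qw [t zE]] : exists2 w, fpow k.+1 w & exists t, z = w + x * t.
    have [[u [j [t [_ [v vu] zE]]]]|[c' [t zE]]] := expand_mod_x n z.
      have : hits k j.
        exists (v * z); split; first exact: idealM.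
        exists (v * t); rewrite zE.
        by transitivity (v * u * y ^+ j + v * t * x); [ring | rewrite vu; ring].
      move=> /dmin; rewrite dk => /subnK jE.
      have [w [qw [t' wE]]] := dhit k.+1.
      exists (u * y ^+ (j - d k.+1) * w); first exact: idealM.
      exists (t - u * y ^+ (j - d k.+1) * t').
      by rewrite zE wE -{1}jE exprD; ring.
    exists 0; first exact: ideal0.
    by exists (c' * c + t); rewrite zE ynx; ring.
  exists w => //; exists t => //.
  have [s [r [ps sr]]] : fpow k (x * t).
    have -> : x * t = z - w by rewrite zE; ring.
    by apply: idealB => //; apply: fpow_dec.
  exists (s * x), r; split; first exact: pM.
  by rewrite -sr; ring.
have [|s [t [ps sf]]] := qsub (f0 ^+ k).
  by exists 1, 1; split=> //; ring.
apply: ps; have -> : s = t * f0; last exact: idealM.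
by apply: (mulIf (expf_neq0 k f0_neq0)); rewrite sf exprS; ring.
Qed.

End Prime.

(** Since no power of [y] is a multiple of [x], an [f] with [y * f] in [(x)] is
    divisible modulo [x] by all powers of [y]; then it is in [(x)], because the
    ascending chain of the ideals [(x : y^n)] is stationary. *)
Lemma regular_seq_xy f c : y * f = c * x -> exists d, f = d * x.
Proof.
have [p [pp pm [f0 pf0 f00]]] : exists p, [/\ prime_ideal p, m `<=` p -> False &
    exists2 f, p f & f != 0].
  case: hR => _ _ [[p [pp plt]] _] _.
  exists (p 1%N); split; first exact: pp.
    move=> mp; have [_ +] := plt 1%N isT; apply.
    apply: subset_trans mp; have /prime_idealP[Pi P1 _] := pp 2 isT.
    exact: proper_ideal_sub_lmax.
  have [_ p01] := plt 0%N isT.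
  apply: contrapT => nf; apply: p01 => g pg.
  have -> : g = 0 by apply/eqP; apply/negP => /negP g0; apply: nf; exists g.
  by have /prime_idealP[/ideal0] := pp 0%N isT.
have [Pi P1 Pmul] : [/\ ideal p, ~ p 1 & forall u v, p (u * v) -> p u \/ p v].
  exact/prime_idealP.
have yx n d : y ^+ n <> d * x.
  have [px ynx|px] := pselect (p x); last exact: (pow_y_notin_x pp pf0 f00 px).
  apply: pm => z /lmaxP[s [t ->]]; apply: idealD => //; first exact: idealM.
  apply: idealM => //.
  have : p (y ^+ n) by rewrite ynx; exact: idealM.
  by elim: n {ynx} => [/P1//|n IHn]; rewrite exprS => /Pmul[].
move=> yf.
(* If [f] were a unit times [y^k] modulo [x], then [y^(k + 1)] would be in [(x)]. *)
have fdiv n : exists c t, f = c * y ^+ n + t * x.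
  have [[u [k [t [_ [w wu] fE]]]]|//] := expand_mod_x n f.
  case: (yx k.+1 (w * (c - t * y))).
  transitivity (w * u * y ^+ k.+1); first by rewrite wu mul1r.
  transitivity (w * (y * f - y * (t * x))); first by rewrite fE exprS; ring.
  by rewrite yf; ring.
have [|n z|N Nmax] := @noetherian_chain _ noethR (fun n => colon (principal x) (y ^+ n)).
- by move=> n; apply/colon_ideal/principal_ideal.
- by move=> [d zE]; exists (d * y); rewrite exprSr mulrA zE; ring.
have [d [t fE]] := fdiv N.
have [|d' dE] := Nmax N.+1 d.
  exists (c - t * y); rewrite mulrBl -yf fE exprS; ring.
by exists (d' + t); rewrite fE dE; ring.
Qed.

End LocalRing.

(** * Monomials in a regular system of parameters *)

Section Monomials.
Variables (R : idomainType) (m : set R) (x y : R).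
Hypothesis hR : regular_local2 m x y.
Implicit Types (J : set R) (c z w f g : R) (S : nat -> nat -> Prop).

Lemma param_neq0 : x != 0.
Proof.
apply/eqP => x0; have [|d d1] := @regular_seq_xy _ _ _ _ (regular_local2_sym hR) 1 0.
  by rewrite x0; ring.
by apply: (lmax1 hR); rewrite d1; apply: (idealM _ (lmax_ideal hR) (lmax_y hR)).
Qed.

Lemma regular_seq_pow i j f c : y ^+ j * f = c * x ^+ i -> exists d, f = d * x ^+ i.
Proof.
elim: i f c => [|i IHi] f c yf; first by exists f; ring.
have [d fE] : exists d, f = d * x.
  move: yf {IHi}; rewrite exprSr mulrA; move: (c * x ^+ i) => c' yf.
  elim: j c' yf => [|j IHj] c'; first by rewrite expr0 mul1r; exists c'.
  by rewrite exprS -mulrA => /(regular_seq_xy hR)[d /IHj].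
have [d' dE] : exists d', d = d' * x ^+ i.
  apply: (IHi _ c); apply: (mulIf param_neq0).
  by rewrite -[LHS]mulrA -fE yf exprSr; ring.
by exists d'; rewrite fE dE exprSr; ring.
Qed.

(** Monomials are independent modulo [m]; everything about monomial ideals below
    rests on this. *)
Lemma monomial_indep i j c s t :
  c * (x ^+ i * y ^+ j) = s * x ^+ i.+1 + t * y ^+ j.+1 -> m c.
Proof.
move=> cE; have [|d dE] := @regular_seq_pow i.+1 j (c * x ^+ i - t * y) s.
  transitivity (c * (x ^+ i * y ^+ j) - t * y ^+ j.+1); first by rewrite exprS; ring.
  by rewrite cE addrK.
have tE : t * y = c * x ^+ i - d * x ^+ i.+1 by rewrite -dE; ring.
have [|d' d'E] := @regular_seq_pow i 1 t (c - d * x).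
  by rewrite expr1 mulrC tE exprS; ring.
apply/(lmaxP hR); exists d, d'; apply: (mulIf (expf_neq0 i param_neq0)).
by rewrite -[LHS](subrK (t * y)) dE d'E exprS; ring.
Qed.

Definition mono S : set R :=
  ideal_gen [set z | exists i j, S i j /\ z = x ^+ i * y ^+ j].

Lemma mono_ideal S : ideal (mono S).
Proof. exact: ideal_gen_ideal. Qed.

Lemma mono_sub S J : ideal J -> (forall i j, S i j -> J (x ^+ i * y ^+ j)) ->
  mono S `<=` J.
Proof. by move=> Ji SJ; apply: ideal_gen_sub => // z [i [j [Sij ->]]]; apply: SJ. Qed.

Lemma mono_ge S i j k l : S i j -> (i <= k)%N -> (j <= l)%N ->
  mono S (x ^+ k * y ^+ l).
Proof.
move=> Sij /subnK kE /subnK lE.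
have -> : x ^+ k * y ^+ l = x ^+ (k - i) * y ^+ (l - j) * (x ^+ i * y ^+ j).
  by rewrite -{1}kE -{1}lE !exprD; ring.
apply: (idealM _ (mono_ideal S)).
by apply: ideal_gen_gen; exists i, j.
Qed.

Lemma mono_gen S i j : S i j -> mono S (x ^+ i * y ^+ j).
Proof. by move=> Sij; apply: mono_ge Sij _ _. Qed.

Lemma mono_mul S S' S'' z w : (forall i j k l, S i j -> S' k l -> S'' (i + k)%N (j + l)%N) ->
  mono S z -> mono S' w -> mono S'' (z * w).
Proof.
move=> SS Sz Sw; suff /(_ z Sz) : mono S `<=` colon (mono S'') w by [].
apply: mono_sub => [|i j Sij]; first exact/colon_ideal/mono_ideal.
rewrite /colon /= mulrC.
suff /(_ w Sw) : mono S' `<=` colon (mono S'') (x ^+ i * y ^+ j) by [].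
apply: mono_sub => [|k l Skl]; first exact/colon_ideal/mono_ideal.
rewrite /colon /=.
have -> : x ^+ k * y ^+ l * (x ^+ i * y ^+ j) = x ^+ (i + k) * y ^+ (j + l).
  by rewrite !exprD; ring.
by apply: mono_gen; apply: SS.
Qed.

Lemma mono_coef S i j c : (forall k l, S k l -> (i < k)%N \/ (j < l)%N) ->
  mono S (c * (x ^+ i * y ^+ j)) -> m c.
Proof.
move=> SP; set J := [set z | exists s t, z = s * x ^+ i.+1 + t * y ^+ j.+1].
suff SJ : mono S `<=` J by move=> /SJ[s [t]]; apply: monomial_indep.
have Ji : ideal J.
  apply/idealP; split; first by exists 0, 0; ring.
  by move=> d _ _ [s [t ->]] [s' [t' ->]]; exists (d * s + s'), (d * t + t'); ring.
apply: mono_sub => // k l /SP[/subnK kE|/subnK lE].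
  by exists (x ^+ (k - i.+1) * y ^+ l), 0; rewrite -{1}kE exprD; ring.
by exists 0, (x ^+ k * y ^+ (l - j.+1)); rewrite -{1}lE exprD; ring.
Qed.

Lemma mono_monomial S i j : mono S (x ^+ i * y ^+ j) ->
  exists k l, [/\ S k l, (k <= i)%N & (l <= j)%N].
Proof.
move=> Sij; apply: contrapT => nS; apply: (lmax1 hR).
apply: (@mono_coef S i j); last by rewrite mul1r.
move=> k l Skl; have [|ki] := ltnP i k; first by left.
by have [|lj] := ltnP j l; [right | case: nS; exists k, l].
Qed.

(** ** Monomial valuations *)

Section Weights.
Variables al be : nat.
Hypotheses (al_gt0 : (0 < al)%N) (be_gt0 : (0 < be)%N).

Definition wt n := mono (fun i j => n <= al * i + be * j)%N.

(** A refinement of the filtration [wt], in which each graded piece is spanned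
    by at most one monomial. *)
Definition wt_from n k := mono (fun i j => n < al * i + be * j \/
  n = al * i + be * j /\ k <= i)%N.

Lemma wt_ideal n : ideal (wt n).
Proof. exact: mono_ideal. Qed.

Lemma wt0 z : wt 0 z.
Proof.
rewrite -[z]mulr1; apply: (idealM _ (wt_ideal 0)).
by rewrite -[1]mulr1 -[X in _ * X](expr0 y) -{1}(expr0 x); apply: mono_gen.
Qed.

Lemma wt_monomial n i j : (n <= al * i + be * j)%N -> wt n (x ^+ i * y ^+ j).
Proof. by move=> h; apply: mono_gen. Qed.

Lemma wt_anti n k : (k <= n)%N -> wt n `<=` wt k.
Proof.
move=> kn; apply: mono_sub => [|i j nij]; first exact: wt_ideal.
by apply: wt_monomial; apply: leq_trans nij.
Qed.

Lemma wt_mul n p z w : wt n z -> wt p w -> wt (n + p) (z * w).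
Proof. by apply: mono_mul => i j k l nij pkl; rewrite !mulnDr addnACA leq_add. Qed.

Lemma wt_step n k z : wt_from n k z -> ~ wt_from n k.+1 z ->
  exists c j, [/\ n = (al * k + be * j)%N, ~ m c &
    wt_from n k.+1 (z - c * (x ^+ k * y ^+ j))].
Proof.
have Fi := mono_ideal (fun i j => n < al * i + be * j \/
  n = al * i + be * j /\ k.+1 <= i)%N; rewrite -/(wt_from _ _) in Fi.
move=> Fz nFz; have [j nE] : exists j, n = (al * k + be * j)%N.
  apply: contrapT => nj; apply: nFz; move: z Fz; apply: mono_sub => // i j ij.
  apply: mono_gen; have [ik|/eqP ik] := eqVneq i k; last by lia.
  by case: ij => [|[nE _]]; [left | case: nj; exists j; rewrite -ik].
have [c cz] : exists c, wt_from n k.+1 (z - c * (x ^+ k * y ^+ j)).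
  move: z Fz {nFz}.
  apply: (@mono_sub _ [set z | exists c, wt_from n k.+1 (z - c * (x ^+ k * y ^+ j))]).
    apply/idealP; split; first by exists 0; rewrite mul0r subr0; exact: ideal0.
    move=> d u v [c cu] [c' cv]; exists (d * c + c').
    have -> : d * u + v - (d * c + c') * (x ^+ k * y ^+ j) =
      d * (u - c * (x ^+ k * y ^+ j)) + (v - c' * (x ^+ k * y ^+ j)) by ring.
    by apply: (idealD Fi) => //; apply: (idealM _ Fi).
  move=> i l il; have [ik|/eqP ik] := eqVneq i k.
    have [lj|/eqP lj] := eqVneq l j.
      by exists 1; rewrite ik lj mul1r subrr; exact: ideal0.
    by exists 0; rewrite mul0r subr0; apply: mono_gen; subst i; nia.
  by exists 0; rewrite mul0r subr0; apply: mono_gen; lia.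
exists c, j; split=> // /(lmaxP hR)[s [t cE]]; apply: nFz.
rewrite -[z](subrK (c * (x ^+ k * y ^+ j))); apply: (idealD Fi) => //.
have -> : c * (x ^+ k * y ^+ j) = s * (x ^+ k.+1 * y ^+ j) + t * (x ^+ k * y ^+ j.+1).
  by rewrite cE !exprS; ring.
by apply: (idealD Fi); apply: (idealM _ Fi); apply: mono_gen; nia.
Qed.

(** The last [wt_from n i] that contains [z] exhibits the monomial with the least
    exponent of [x] in the initial form of [z]. *)
Lemma wt_initial n z : wt n z -> ~ wt n.+1 z ->
  exists c i j, [/\ n = (al * i + be * j)%N, ~ m c &
    wt_from n i.+1 (z - c * (x ^+ i * y ^+ j))].
Proof.
move=> nz nSz; have z0 : wt_from n 0 z.
  move: z nz {nSz}; apply: mono_sub => [|i j ij]; first exact: mono_ideal.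
  by apply: mono_gen; lia.
have zlast : ~ wt_from n n.+1 z.
  move=> zn; apply: nSz; move: z zn {nz z0}; apply: mono_sub; first exact: mono_ideal.
  by move=> i j ij; apply: wt_monomial; nia.
have [k [zk zSk]] : exists k, wt_from n k z /\ ~ wt_from n k.+1 z.
  apply: contrapT => nk; apply: zlast; elim: n.+1 => // k zk.
  by apply: contrapT => zSk; apply: nk; exists k.
by have [c [j cj]] := wt_step zk zSk; exists c, k, j.
Qed.

(** The product of the first monomials of the initial forms of [z] and [w] cannot
    be cancelled by the other terms of [z * w]: they have larger weight, or the
    same weight and a larger exponent of [x]. *)
Lemma wt_mul_exact n p z w : wt n z -> ~ wt n.+1 z -> wt p w -> ~ wt p.+1 w ->
  ~ wt (n + p).+1 (z * w).
Proof.
move=> nz nSz pw pSw zw.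
have [c [i [j [nE mc cz]]]] := wt_initial nz nSz.
have [d [k [l [pE md dw]]]] := wt_initial pw pSw.
suff : m (c * d) by move=> /(lmax_prime hR)[].
set S := (fun a b => n + p < al * a + be * b \/
  n + p = al * a + be * b /\ i + k < a)%N.
apply: (@mono_coef S (i + k) (j + l)); first by move=> a b; rewrite /S nE pE; nia.
have Si := mono_ideal S.
set u := c * (x ^+ i * y ^+ j) in cz; set v := d * (x ^+ k * y ^+ l) in dw.
have -> : c * d * (x ^+ (i + k) * y ^+ (j + l)) =
    z * w - ((z - u) * v + u * (w - v) + (z - u) * (w - v)).
  by rewrite /u /v !exprD; ring.
have Su : mono (fun a b => a = i /\ b = j) u.
  by apply: (idealM _ (mono_ideal _)); apply: mono_gen.
have Sv : mono (fun a b => a = k /\ b = l) v.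
  by apply: (idealM _ (mono_ideal _)); apply: mono_gen.
apply: (idealB Si).
  by move: zw; apply: mono_sub => // a b ab; apply: mono_gen; left.
apply: (idealD Si); first apply: (idealD Si).
- by apply: mono_mul cz Sv => a b a' b' h [-> ->]; rewrite /S; nia.
- by apply: mono_mul Su dw => a b a' b' [-> ->] h; rewrite /S; nia.
- by apply: mono_mul cz dw => a b a' b' h h'; rewrite /S; nia.
Qed.

End Weights.

End Monomials.

(** * Separation *)

Section Separation.
Variables (R : idomainType) (m : set R) (x y : R).
Hypothesis hR : regular_local2 m x y.
Implicit Types (J : set R) (c z w f g : R).

Let noethR : noetherian R. Proof. by case: hR. Qed.

(** If [z = c_n * w^n] for all [n], the ideals [(c_n)] form a strictly increasing
    chain. *)
Lemma pow_separated z w : ~ (exists c, c * w = 1) -> z != 0 ->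
  exists n, ~ principal (w ^+ n) z.
Proof.
move=> wnu z0; apply: contrapT => nz.
have zdiv n : exists c, z = c * w ^+ n by apply: contrapT => nc; apply: nz; exists n.
have w0 : w != 0 by apply/eqP => w0; have [c zE] := zdiv 1%N; move: z0; rewrite zE w0 mulr0 eqxx.
set F := [set J | exists2 c, principal c = J & exists n, z = c * w ^+ n].
have [||_ [c <- [n zE]] Jmax] := @noetherian_max _ noethR F.
- by move=> _ [c <- _]; exact: principal_ideal.
- by exists (principal z); exists z => //; exists 0%N; rewrite mulr1.
have [d zE'] := zdiv n.+1.
have cE : c = d * w.
  by apply: (mulIf (expf_neq0 n w0)); rewrite -zE zE' exprS; ring.
have [||a dE] := Jmax (principal d) _ _ d (principal_self d).
- by exists d => //; exists n.+1.
- by move=> _ [a ->]; exists (a * w); rewrite cE; ring.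
apply: wnu; exists a.
have d0 : d != 0 by apply: contra_neq z0 => d0; rewrite zE' d0 mul0r.
by apply: (mulIf d0); rewrite mul1r {2}dE cE; ring.
Qed.

(** The argument of [pow_separated] in the domain [R / x]. *)
Lemma mod_x_separated z : (forall n, exists c t, z = c * y ^+ n + t * x) ->
  principal x z.
Proof.
move=> zdiv.
have regx n a t : a * y ^+ n = t * x -> principal x a.
  by move=> E; have [|d dE] := @regular_seq_pow _ _ _ _ hR 1 n a t; [rewrite mulrC E | exists d].
set F := [set J | exists2 c, ideal_adjoin (principal x) c = J &
  exists n t, z = c * y ^+ n + t * x].
have [||_ [c <- [n [t zE]]] Jmax] := @noetherian_max _ noethR F.
- by move=> _ [c <- _]; apply/ideal_adjoin_ideal/principal_ideal.
- by exists (ideal_adjoin (principal x) z); exists z => //; exists 0%N, 0; ring.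
have [d [t' zE']] := zdiv n.+1.
have [s cE] : principal x (c - d * y).
  apply: (regx n _ (t' - t)); apply/eqP; rewrite -subr_eq0; apply/eqP.
  transitivity ((c * y ^+ n + t * x) - (d * y ^+ n.+1 + t' * x)); last by rewrite -zE -zE' subrr.
  by rewrite exprS; ring.
have xi := principal_ideal x.
have [||u [u' uE] [a dE]] := Jmax (ideal_adjoin (principal x) d) _ _ d (ideal_adjoin_gen d xi).
- by exists d => //; exists n.+1, t'.
- move=> _ [u xu [a ->]]; exists (u + a * s * x).
    by apply: idealD => //; exists (a * s).
  by exists (a * y); rewrite -[c](subrK (d * y)) cE; ring.
have xc : principal x c.
  apply: (lmax_cancel (t := a) hR xi (lmax_y hR)); exists (s + u' * y).
  by rewrite -[X in X - _](subrK (d * y)) cE {1}dE uE; ring.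
rewrite zE; apply: (idealD xi); last by exists t.
by rewrite mulrC; apply: idealM.
Qed.

(** Separation is tested first along powers of [x] and then, modulo [x], along
    powers of [y]; an ideal [(x^(k + 1), y^l)] contains all monomials of large
    weight. *)
Lemma wt_separated al be z : (0 < al)%N -> (0 < be)%N -> z != 0 ->
  exists n, ~ wt x y al be n z.
Proof.
move=> al0 be0 z0.
have xnu : ~ exists c, c * x = 1.
  move=> [c cx]; apply: (lmax1 hR); rewrite -cx; apply: idealM; first exact: (lmax_ideal hR).
  exact: (lmax_x hR).
have [k [[w zE] wx]] : exists k, (exists w, z = w * x ^+ k) /\ ~ principal (x ^+ k.+1) z.
  have [n [nz nmin]] := ex_least (pow_separated xnu z0).
  case: n nz nmin => [nz _|k nz kmin]; first by case: nz; exists z; rewrite mulr1.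
  exists k; split=> //; apply: contrapT => nk.
  by have := kmin k nk; rewrite ltnn.
have [l wl] : exists l, ~ exists c t, w = c * y ^+ l + t * x.
  apply: contrapT => nl; apply: wx.
  have [|t wE] := @mod_x_separated w; last by exists t; rewrite zE wE exprS; ring.
  by move=> n; apply: contrapT => nn; apply: nl; exists n.
exists (al * k + be * l)%N => zwt.
have [s [t zE']] : exists s t, z = s * x ^+ k.+1 + t * y ^+ l.
  move: z zwt {z0 zE wx}.
  apply: (@mono_sub R x y _ [set z | exists s t, z = s * x ^+ k.+1 + t * y ^+ l]).
    apply/idealP; split; first by exists 0, 0; ring.
    by move=> d _ _ [s [t ->]] [s' [t' ->]]; exists (d * s + s'), (d * t + t'); ring.
  move=> i j ij; have [/subnK iE|ik] := ltnP k i.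
    by exists (x ^+ (i - k.+1) * y ^+ j), 0; rewrite -{1}iE exprD; ring.
  have /subnK jE : (l <= j)%N by nia.
  by exists 0, (x ^+ i * y ^+ (j - l)); rewrite -{1}jE exprD; ring.
have [|d tE] := @regular_seq_pow _ _ _ _ hR k l t (w - s * x).
  transitivity (z - s * x ^+ k.+1); first by rewrite zE'; ring.
  by rewrite zE exprS; ring.
apply: wl; exists d, s; apply: (mulIf (expf_neq0 k (param_neq0 hR))).
by rewrite -zE zE' tE exprS; ring.
Qed.

(** A prime [P] other than [m] that does not contain [x]: its image in the
    discrete valuation ring [R / x] is generated by the class of a power of
    [y], and [P] meets [(x)] in [x P], so by Nakayama's lemma any preimage in
    [P] of the generator generates [P]. *)
Lemma prime_principal_notin_x (P : set R) : prime_ideal P -> ~ P x ->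
  (exists2 z, P z & z != 0) -> exists f, P = principal f.
Proof.
move=> /prime_idealP[Pi P1 Pmul] Px [h Ph h0].
have Pdivx z : P (x * z) -> P z by move=> /Pmul[].
have [g Pg gx] : exists2 g, P g & ~ principal x g.
  apply: contrapT => nP; move/eqP: h0; apply.
  suff /(_ h Ph) : P `<=` [set 0] by [].
  apply: (@nakayama _ _ _ _ hR P [set 0] x) => //; last 1 first.
  - move=> u Pu; exists 0 => //; have [v uE] : principal x u.
      by apply: contrapT => xu; apply: nP; exists u.
    by exists v; [apply: Pdivx; rewrite mulrC -uE | rewrite uE; ring].
  - by apply/idealP; split=> // c _ _ -> ->; rewrite /=; ring.
  - exact: (lmax_x hR).
have Qex : exists k t, P (y ^+ k + t * x).
  apply: contrapT => nQ; apply: gx; apply: mod_x_separated => n.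
  have [[u [k [t [_ [w wu] gE]]]]|//] := expand_mod_x hR n g.
  case: nQ; exists k, (w * t); have -> : y ^+ k + w * t * x = w * g.
    by rewrite gE mulrDr !mulrA wu mul1r.
  exact: idealM.
have [k [[t Pf] kmin]] := ex_least Qex.
exists (y ^+ k + t * x); apply/seteqP; split; last first.
  by move=> _ [c ->]; apply: idealM.
apply: (@nakayama _ _ _ _ hR P (principal (y ^+ k + t * x)) x) => //.
- exact: principal_ideal.
- exact: (lmax_x hR).
move=> p Pp; have [[u [j [s [jk [w wu] pE]]]]|[c [s pE]]] := expand_mod_x hR k p.
  suff /kmin : exists s, P (y ^+ j + s * x) by rewrite leqNgt jk.
  exists (w * s); have -> : y ^+ j + w * s * x = w * p.
    by rewrite pE mulrDr !mulrA wu mul1r.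
  exact: idealM.
exists (c * (y ^+ k + t * x)); first by exists c.
have pE' : p = c * (y ^+ k + t * x) + x * (s - c * t) by rewrite pE; ring.
exists (s - c * t) => //; apply: Pdivx.
have -> : x * (s - c * t) = p - c * (y ^+ k + t * x) by rewrite {1}pE'; ring.
by apply: idealB => //; apply: idealM.
Qed.

End Separation.

Lemma prime_principal (R : idomainType) (m : set R) (x y : R) (P : set R) :
  regular_local2 m x y -> prime_ideal P -> ~ m `<=` P ->
  (exists2 z, P z & z != 0) -> exists f, P = principal f.
Proof.
move=> hR Pp mP Pnz.
have [Px|Px] := pselect (P x); last exact (prime_principal_notin_x hR Pp Px Pnz).
have [Py|Py] := pselect (P y); last first.
  exact (prime_principal_notin_x (regular_local2_sym hR) Pp Py Pnz).
have /prime_idealP[Pi _ _] := Pp.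
case: mP => z /(lmaxP hR)[s [t ->]].
by apply: idealD => //; apply: idealM.
Qed.

(** * Discrete valuations *)

Section Valuation.
Variable R : idomainType.
Local Notation K := {fraction R}.
Local Notation "z %:F" := (@tofrac R z).

(** The filtrations [F n = {z | n <= v z}] of [R] by the discrete valuations [v]
    of its fraction field that are nonnegative on [R]; [vf_step] says that the
    value group is the whole group of integers. *)
Record valuation_filtration (F : nat -> set R) : Prop := ValuationFiltration {
  vf_ideal : forall n, ideal (F n);
  vf_anti : forall n, F n.+1 `<=` F n;
  vf_full : forall z, F 0%N z;
  vf_mul : forall n p z w, F n z -> F p w -> F (n + p)%N (z * w);
  vf_exact : forall n p z w, F n z -> ~ F n.+1 z -> F p w -> ~ F p.+1 w ->
    ~ F (n + p).+1 (z * w);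
  vf_separated : forall z, z != 0 -> exists n, ~ F n z;
  vf_step : exists n z w, [/\ F n z, ~ F n.+1 z, F n.+1 w & ~ F n.+2 w] }.

Lemma frac_numden (f : K) : exists z h, h != 0 /\ f = z%:F / h%:F.
Proof.
elim/quotW: f => r; exists (\n_r), (\d_r); split; first exact: denom_ratioP.
have d0 : (\d_r)%:F != 0 :> K by rewrite tofrac_eq0 denom_ratioP.
apply: (mulIf d0); rewrite divfK //.
rewrite /tofrac; unlock tofrac; rewrite -[LHS]FracField.pi_mul; apply/eqP.
rewrite FracField.equivf_def /FracField.mulf !numden_Ratio ?mulf_neq0 ?oner_neq0 ?denom_ratioP //.
by rewrite mulr1 mulrC mulr1.
Qed.

End Valuation.

Section FiltrationValuation.
Variable R : idomainType.
Local Notation K := {fraction R}.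
Local Notation "z %:F" := (@tofrac R z).
Variable F : nat -> set R.
Hypothesis vF : valuation_filtration F.

Lemma filtration_order : exists o : R -> nat,
  forall z : R, z != 0 -> forall n, F n z <-> (n <= o z)%N.
Proof.
have Fanti n k z : (k <= n)%N -> F n z -> F k z.
  move=> /subnK <-; elim: (n - k)%N => // j IHj /(vf_anti vF); exact: IHj.
have /choice[o oP] (z : R) : exists n, z != 0 -> F n z /\ ~ F n.+1 z.
  have [->|z0] := eqVneq z 0; first by exists 0%N.
  have [n [nz nmin]] := ex_least (vf_separated vF z0).
  case: n nz nmin => [[]|n nz nmin]; first exact: (vf_full vF).
  by exists n => _; split=> //; apply: contrapT => /nmin; rewrite ltnn.
exists o => z z0 n; have [Fz nFz] := oP z z0; split=> [Fnz|/Fanti]; last exact.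
by rewrite leqNgt; apply/negP => /Fanti /(_ Fnz).
Qed.

(** The order with respect to [F] is additive by [vf_exact], so the difference of
    the orders of numerator and denominator is a valuation. *)
Lemma filtration_dvr : exists V : set K, [/\ dvr V, range (@tofrac R) `<=` V &
  forall z h : R, h != 0 -> (V (z%:F / h%:F) <-> forall n, F n h -> F n z)].
Proof.
have [o oP] := filtration_order.
have oE (z : R) n : z != 0 -> F n z -> ~ F n.+1 z -> o z = n.
  move=> z0 /(oP z z0) no nSo; apply/eqP; rewrite eqn_leq no andbT leqNgt.
  by apply/negP => /(oP z z0).
have oM (z w : R) : z != 0 -> w != 0 -> o (z * w) = (o z + o w)%N.
  move=> z0 w0; apply: oE; first by rewrite mulf_neq0.
    by apply: (vf_mul vF); apply/oP.
  by apply: (vf_exact vF); rewrite ?oP // ltnn.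
have o1 : o 1 = 0%N.
  by have := oM 1 1 (oner_neq0 _) (oner_neq0 _); rewrite mulr1; lia.
have oD (z w : R) : z != 0 -> w != 0 -> z + w != 0 -> (minn (o z) (o w) <= o (z + w)%R)%N.
  move=> z0 w0 zw0; apply/oP => //; apply: (idealD (vf_ideal vF _)).
    by apply/oP => //; rewrite geq_minl.
  by apply/oP => //; rewrite geq_minr.
have oX (z : R) n : z != 0 -> o (z ^+ n) = (n * o z)%N.
  by move=> z0; elim: n => // n IHn; rewrite exprS oM ?expf_neq0 // IHn mulSn.
have /choice[num /choice[den fE]] := @frac_numden R.
pose v (f : K) : int := (o (num f))%:Z - (o (den f))%:Z.
have vE (z h : R) : z != 0 -> h != 0 -> v (z%:F / h%:F) = (o z)%:Z - (o h)%:Z.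
  move=> z0 h0; rewrite /v; set f := z%:F / h%:F; have [d0 fE'] := fE f.
  have E : num f * h = z * den f.
    apply/eqP; rewrite -tofrac_eq !tofracM; apply/eqP.
    have h0' : h%:F != 0 by rewrite tofrac_eq0.
    have d0' : (den f)%:F != 0 by rewrite tofrac_eq0.
    by apply: (mulIf (invr_neq0 d0')); rewrite mulfK // mulrAC -fE' /f divfK.
  have n0 : num f != 0.
    by apply/eqP => n0; move/eqP: E; rewrite n0 mul0r eq_sym mulf_eq0 (negPf z0) (negPf d0).
  by have := congr1 o E; rewrite !oM //; lia.
have numden (f : K) : f != 0 -> exists z h : R, [/\ z != 0, h != 0 & f = z%:F / h%:F].
  move=> f0; have [d0 fE'] := fE f; exists (num f), (den f); split=> //.
  by apply: contra_neq f0 => n0; rewrite fE' n0 tofrac0 mul0r.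
have vdv : discrete_valuation v.
  split.
  - move=> f g /numden[z [h [z0 h0 ->]]] /numden[w [k [w0 k0 ->]]].
    rewrite mulf_div -!tofracM !vE ?mulf_neq0 // !oM //; lia.
  - move=> f g /numden[z [h [z0 h0 ->]]] /numden[w [k [w0 k0 ->]]].
    rewrite addf_div ?tofrac_eq0 // -!tofracM -tofracD => zw0.
    have {}zw0 : z * k + w * h != 0 by apply: contra_neq zw0 => ->; rewrite tofrac0 mul0r.
    rewrite !vE ?mulf_neq0 //; have := oD _ _ _ _ zw0; rewrite !oM ?mulf_neq0 //.
    by move=> /(_ isT isT); lia.
  - have [n [z [w [nz nSz nw nSw]]]] := vf_step vF.
    have nz0 k (u : R) : ~ F k u -> u != 0.
      by move=> nu; apply/eqP => u0; apply: nu; rewrite u0; apply: ideal0 (vf_ideal vF _).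
    have z0 := nz0 _ _ nSz; have w0 := nz0 _ _ nSw.
    have oz := oE z n z0 nz nSz; have ow := oE w n.+1 w0 nw nSw.
    case=> k.
      exists ((w ^+ k)%:F / (z ^+ k)%:F).
        by rewrite mulf_neq0 ?invr_neq0 ?tofrac_eq0 ?expf_neq0.
      by rewrite vE ?expf_neq0 // !oX // oz ow; nia.
    exists ((z ^+ k.+1)%:F / (w ^+ k.+1)%:F).
      by rewrite mulf_neq0 ?invr_neq0 ?tofrac_eq0 ?expf_neq0.
    by rewrite vE ?expf_neq0 // !oX // oz ow NegzE; nia.
exists [set f | f = 0 \/ 0 <= v f]; split; first by exists v.
  move=> _ [z _ <-]; have [->|z0] := eqVneq z 0; first by left; rewrite tofrac0.
  right; rewrite -[z%:F]divr1 -tofrac1 vE ?oner_neq0 // o1; lia.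
move=> z h h0; have [->|z0] := eqVneq z 0.
  split=> [_ n _|_]; first exact: ideal0 (vf_ideal vF _).
  by left; rewrite tofrac0 mul0r.
have zh0 : z%:F / h%:F != 0 by rewrite mulf_neq0 ?invr_neq0 ?tofrac_eq0.
split=> [[/eqP E|]|Fhz]; first by rewrite (negPf zh0) in E.
  by rewrite vE // => voh n /(oP h h0) nh; apply/(oP z z0); lia.
right; rewrite vE //.
have : F (o h) z by apply: Fhz; apply/oP.
by move/(oP z z0); lia.
Qed.

End FiltrationValuation.

(** The [f]-adic order is additive because [f] is prime, and finite because [R] is
    noetherian. *)
Lemma prime_pow_filtration (R : idomainType) (m : set R) (x y f : R) :
  regular_local2 m x y -> prime_ideal (principal f) -> f != 0 ->
  valuation_filtration (fun n => principal (f ^+ n)).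
Proof.
move=> hR /prime_idealP[fi f1 fM] f0.
have fk0 k : f ^+ k != 0 by rewrite expf_neq0.
have exactE n c : principal (f ^+ n.+1) (c * f ^+ n) -> principal f c.
  move=> [d E]; exists d; apply: (mulIf (fk0 n)); rewrite E exprS; ring.
split.
- by move=> n; exact: principal_ideal.
- by move=> n _ [c ->]; exists (c * f); rewrite exprS mulrA.
- by move=> z; exists z; rewrite mulr1.
- by move=> n p _ _ [c ->] [d ->]; exists (c * d); rewrite exprD; ring.
- move=> n p _ _ [c ->] nc [d ->] nd.
  have -> : c * f ^+ n * (d * f ^+ p) = c * d * f ^+ (n + p) by rewrite exprD; ring.
  move=> /exactE /fM[[a cE]|[a dE]]; [apply: nc|apply: nd].
    by exists a; rewrite cE exprS; ring.
  by exists a; rewrite dE exprS; ring.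
- move=> z z0; apply: (pow_separated hR _ z0) => -[c cf].
  by apply: f1; exists c.
- exists 0%N, 1, f; split.
  + by exists 1; rewrite mulr1.
  + by rewrite expr1.
  + by exists 1; rewrite mul1r expr1.
  + by rewrite expr2 => -[c fE]; apply: f1; exists c; apply: (mulIf f0); rewrite mul1r {1}fE mulrA.
Qed.

(** [R] is the intersection of the discrete valuation rings between [R] and its
    fraction field. If [h] does not divide [g], a maximal proper colon ideal
    [(h : c * g)] is a prime [P]; it is not [m] because [x, y] is a regular
    sequence, so [P] is generated by one element [f], and [c * g / h] has [f]-adic
    value [-1]. *)
Lemma in_all_dvr (R : idomainType) (m : set R) (x y : R) (k : {fraction R}) :
  regular_local2 m x y ->
  (forall V, dvr V -> range (@tofrac R) `<=` V -> V k) ->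
  exists z, k = @tofrac R z.
Proof.
move=> hR kV; have [g [h [h0 kE]]] := frac_numden k.
have hF0 : @tofrac R h != 0 by rewrite tofrac_eq0.
have [[c gE]|hg] := pselect (principal h g).
  by exists c; rewrite kE gE tofracM mulfK.
exfalso.
have hi := principal_ideal h.
set Q := [set J | exists2 c, ~ principal h (c * g) & colon (principal h) (c * g) = J].
have noethR : noetherian R by case: hR.
have [||_ [c hcg <-] Qmax] := @noetherian_max _ noethR Q.
- by move=> _ [c _ <-]; exact: colon_ideal.
- by exists (colon (principal h) (1 * g)); exists 1; rewrite ?mul1r.
set w := c * g in hcg Qmax.
have Pi : ideal (colon (principal h) w) by exact: colon_ideal.
have Pp : prime_ideal (colon (principal h) w).
  apply/prime_idealP; split=> //; first by rewrite /colon /= mul1r.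
  move=> u u' Puu; have [|nu] := pselect (principal h (u * w)); first by left.
  right; apply: (Qmax (colon (principal h) (u * w))).
  - by exists (u * c); rewrite -mulrA.
  - by move=> z Pz; rewrite /colon /= mulrCA; apply: idealM.
  - by rewrite /colon /= mulrA [u' * u]mulrC.
have nmP : ~ m `<=` colon (principal h) w.
  move=> mP; have [s sE] := mP _ (lmax_x hR); have [t tE] := mP _ (lmax_y hR).
  have [|d sE'] := @regular_seq_xy _ _ _ _ hR s t.
    apply: (mulIf h0); transitivity (y * (x * w)); first by rewrite sE; ring.
    by rewrite mulrCA tE; ring.
  apply: hcg; exists d; apply: (mulIf (param_neq0 hR)).
  by rewrite mulrC sE sE'; ring.
have [|f Pf] := prime_principal hR Pp nmP.
  by exists h => //; rewrite /colon /=; exists w; rewrite mulrC.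
have f0 : f != 0.
  apply/eqP => f0; have : principal f h by rewrite -Pf; exists w; rewrite mulrC.
  by case=> d; rewrite f0 mulr0 => /eqP; rewrite (negPf h0).
have [t tE] : principal h (f * w).
  by have : principal f f by [exact: principal_self]; rewrite -{1}Pf.
rewrite Pf in Pp.
have [V [Vdvr RV VP]] := filtration_dvr (prime_pow_filtration hR Pp f0).
have /(VP g h h0) Fhg : V (@tofrac R g / @tofrac R h) by rewrite -kE; apply: kV.
have vF := prime_pow_filtration hR Pp f0.
have [n [nh nSh]] : exists n, principal (f ^+ n) h /\ ~ principal (f ^+ n.+1) h.
  have [n [nh nmin]] := ex_least (vf_separated vF h0).
  case: n nh nmin => [[]|n nh nmin]; first exact: (vf_full vF).
  by exists n; split=> //; apply: contrapT => /nmin; rewrite ltnn.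
have ft : ~ principal (f ^+ 1) t.
  move=> [d tE']; apply: hcg; exists d; apply: (mulIf f0).
  by rewrite mulrC tE tE'; ring.
apply: (vf_exact vF (vf_full vF t) ft nh nSh); rewrite -tE add0n -add1n.
apply: (vf_mul vF); first by exists 1; rewrite mul1r.
by apply: idealM; [exact: principal_ideal | exact: Fhg].
Qed.

(** * Simple complete monomial ideals *)

Section IdealPowers.
Variable R : comNzRingType.
Implicit Types (I : set R) (z w : R).

Lemma ideal_pow_ideal I n : ideal (ideal_pow I n).
Proof.
case: n => [|n]; first exact: ideal_setT.
exact: ideal_gen_ideal.
Qed.

Lemma ideal_powS I n z w : I z -> ideal_pow I n w -> ideal_pow I n.+1 (z * w).
Proof. by move=> Iz Iw; apply: ideal_gen_gen; exists z => //; exists w. Qed.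

Lemma ideal_pow_mul I n p z w : I z -> I w -> ideal_pow I (n + p) (z ^+ n * w ^+ p).
Proof.
move=> Iz Iw; elim: n => [|n IHn].
  rewrite mul1r; elim: p => // p IHp; rewrite exprS; exact: ideal_powS.
by rewrite exprS -mulrA; apply: ideal_powS.
Qed.

(** The equation of integral dependence is [X^n - z^n = 0]. *)
Lemma complete_root I n z : complete_ideal I -> (0 < n)%N ->
  ideal_pow I n (z ^+ n) -> I z.
Proof.
move=> [_ Icl] n0 Izn; apply: Icl; exists n, (fun i => if i == n then - z ^+ n else 0).
split=> // [i _|].
  case: eqP => [->|_]; last exact: ideal0 (ideal_pow_ideal _ _).
  by apply: idealN Izn; exact: ideal_pow_ideal.
rewrite big_nat_recr //= eqxx subnn mulr1 big_nat big1 ?add0r ?subrr // => i /andP[_ ilt].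
by rewrite (ltn_eqF ilt) mul0r.
Qed.

End IdealPowers.

Section CompleteMonomial.
Variables (R : idomainType) (m : set R) (x y : R).
Hypothesis hR : regular_local2 m x y.
Implicit Types (I : set R).

(** The exponents of a complete monomial ideal form a convex region: the
    [n + p]-th power of the monomial is a multiple of a product of [n] copies of one
    given monomial and [p] copies of the other. *)
Lemma complete_convex I i j k l n p u v : complete_ideal I ->
  I (x ^+ i * y ^+ j) -> I (x ^+ k * y ^+ l) -> (0 < n + p)%N ->
  (n * i + p * k <= (n + p) * u)%N -> (n * j + p * l <= (n + p) * v)%N ->
  I (x ^+ u * y ^+ v).
Proof.
move=> Ic Iij Ikl np0 /subnK uE /subnK vE; apply: (complete_root Ic np0).
rewrite exprMn -!exprM [(u * _)%N]mulnC [(v * _)%N]mulnC -uE -vE.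
rewrite !exprD.
set c := x ^+ (_ - _); set d := y ^+ (_ - _).
have -> : c * (x ^+ (n * i) * x ^+ (p * k)) * (d * (y ^+ (n * j) * y ^+ (p * l))) =
   c * d * ((x ^+ i * y ^+ j) ^+ n * (x ^+ k * y ^+ l) ^+ p).
  rewrite !exprMn -!exprM ![(_ * n)%N]mulnC ![(_ * p)%N]mulnC; ring.
by apply: idealM; [exact: ideal_pow_ideal | exact: ideal_pow_mul].
Qed.

(** Let [x^A y^B] in [I] have minimal weight. The lines through [(A, B)] parallel
    to the axes cut the Newton polygon of [I] in two, and [I] is the product of
    the ideals of the two pieces, shifted back to the axes. *)
Lemma complete_split I S A B al be : complete_ideal I -> I = mono x y S ->
  (0 < al)%N -> (0 < be)%N -> I (x ^+ A * y ^+ B) ->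
  (forall i j, I (x ^+ i * y ^+ j) -> (al * A + be * B <= al * i + be * j)%N) ->
  ~ I (x ^+ A) -> ~ I (y ^+ B) -> ~ simple_ideal I.
Proof.
move=> Ic IE al0 be0 IAB wmin nIA nIB [Ii Isimple].
pose inI i j := I (x ^+ i * y ^+ j).
have inI_ge i j k l : inI i j -> (i <= k)%N -> (j <= l)%N -> inI k l.
  move=> Iij /subnK kE /subnK lE; rewrite /inI -kE -lE !exprD.
  have -> : x ^+ (k - i) * x ^+ i * (y ^+ (l - j) * y ^+ j) =
    x ^+ (k - i) * y ^+ (l - j) * (x ^+ i * y ^+ j) by ring.
  exact: idealM.
have proper S' : ~ (exists i j, [/\ S' i j, (i <= 0)%N & (j <= 0)%N]) ->
    is_proper_ideal (mono x y S').
  move=> nS; apply/proper_idealP; split; first exact: mono_ideal.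
  by move=> S1; apply: nS; apply: (mono_monomial hR); rewrite !expr0 mulr1.
apply: (Isimple (mono x y (fun i j => inI (i + A)%N j)) (mono x y (fun i j => inI i (j + B)%N))).
- apply: proper => -[i [j [+ i0 j0]]].
  by move: i0 j0; rewrite !leqn0 => /eqP-> /eqP->; rewrite /inI add0n expr0 mulr1.
- apply: proper => -[i [j [+ i0 j0]]].
  by move: i0 j0; rewrite !leqn0 => /eqP-> /eqP->; rewrite /inI add0n expr0 mul1r.
apply/seteqP; split.
  rewrite {1}IE; apply: mono_sub => [|i j Sij]; first exact: ideal_gen_ideal.
  have Iij : inI i j by rewrite /inI IE; apply: mono_gen.
  have := wmin i j Iij; have [/subnK iE _|iA] := leqP A i.
    have -> : x ^+ i * y ^+ j = x ^+ (i - A) * y ^+ j * (x ^+ A * y ^+ 0).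
      by rewrite -{1}iE exprD; ring.
    apply: ideal_gen_gen; exists (x ^+ (i - A) * y ^+ j).
      by apply: mono_gen; rewrite iE.
    by exists (x ^+ A * y ^+ 0) => //; apply: mono_gen.
  have [/subnK jE _|jB] := leqP B j; last first.
    by rewrite leqNgt -addSn leq_add // ?ltn_pmul2l // leq_pmul2l // ltnW.
  have -> : x ^+ i * y ^+ j = x ^+ 0 * y ^+ B * (x ^+ i * y ^+ (j - B)).
    by rewrite -{1}jE exprD; ring.
  apply: ideal_gen_gen; exists (x ^+ 0 * y ^+ B); first by apply: mono_gen.
  by exists (x ^+ i * y ^+ (j - B)) => //; apply: mono_gen; rewrite jE.
apply: ideal_gen_sub => // _ [u Ju [v Jv <-]].
suff SI : mono x y inI `<=` I.
  apply: SI; apply: mono_mul Ju Jv => i j k l; rewrite -!/(inI _ _).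
  move=> P1 P2; have w1 := wmin _ _ P1; have w2 := wmin _ _ P2.
  have [Ak|kA] := leqP A k; first by apply: inI_ge P1 _ _; lia.
  have [Bj|jB] := leqP B j; first by apply: inI_ge P2 _ _; lia.
  have [s sE] : exists s, A = (s + k)%N by exists (A - k)%N; lia.
  have [t tE] : exists t, B = (t + j)%N by exists (B - j)%N; lia.
  have convex : (s * t <= i * l)%N.
    rewrite -(leq_pmul2l al0) -(leq_pmul2l be0).
    have -> : (be * (al * (s * t)) = (al * s) * (be * t))%N by lia.
    have -> : (be * (al * (i * l)) = (be * l) * (al * i))%N by lia.
    by apply: leq_mul; lia.
  have [si|i_s] := leqP s i.
    have [tl|l_t] := leqP t l; first by apply: inI_ge IAB _ _; lia.
    have [d dE] : exists d, t = (d + l)%N by exists (t - l)%N; lia.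
    (* the point lies above the segment from [(A, B)] to the first summand *)
    by apply: (complete_convex (n := l) (p := d) Ic IAB P1); lia.
  have [d dE] : exists d, s = (d + i)%N by exists (s - i)%N; lia.
  by apply: (complete_convex (n := i) (p := d) Ic IAB P2); lia.
by apply: mono_sub.
Qed.

Section Staircase.
Variables (I : set R) (r : nat) (a b : nat -> nat).
Hypotheses (r_ge2 : (2 <= r)%N) (Isimple : simple_ideal I) (Icomplete : complete_ideal I).
Hypothesis Iord : ideal_order m I r.
Hypothesis IE : I = ideal_gen [set x ^+ a i * y ^+ b i | i in [set i | (i <= r)%N]].
Hypotheses (a_dec : forall i, (i < r)%N -> (a i.+1 < a i)%N) (ar : a r = 0%N).
Hypotheses (b0 : b 0%N = 0%N) (b_inc : forall i, (i < r)%N -> (b i < b i.+1)%N).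
Hypothesis ab : (a 0%N <= b r)%N.

Let S i j := exists2 k, (k <= r)%N & i = a k /\ j = b k.

Let I_mono : I = mono x y S.
Proof.
rewrite IE /mono; congr (ideal_gen _); apply/seteqP; split.
  by move=> _ [k kr <-]; exists (a k), (b k); split=> //; exists k.
by move=> _ [_ [_ [[k kr [-> ->]] ->]]]; exists k.
Qed.

Let I_ideal : ideal I. Proof. by case: Icomplete. Qed.

Let I_corner k : (k <= r)%N -> I (x ^+ a k * y ^+ b k).
Proof. by move=> kr; rewrite I_mono; apply: mono_gen; exists k. Qed.

Let I_monomial i j : I (x ^+ i * y ^+ j) -> exists k, [/\ k <= r, a k <= i & b k <= j]%N.
Proof.
by rewrite I_mono => /(mono_monomial hR)[_ [_ [[k kr [-> ->]] ki lj]]]; exists k.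
Qed.

Let b_mono i j : (i + j <= r)%N -> (b i + j <= b (i + j))%N.
Proof.
elim: j => [|j IHj]; first by rewrite !addn0.
rewrite !addnS => ij; exact: leq_ltn_trans (IHj (ltnW ij)) (b_inc ij).
Qed.

Let a_mono i j : (i + j <= r)%N -> (a (i + j) + j <= a i)%N.
Proof.
elim: j => [|j IHj]; first by rewrite !addn0.
rewrite !addnS => ij; apply: leq_trans (IHj (ltnW ij)).
by rewrite ltn_add2r a_dec.
Qed.

Lemma staircase_b_ge i : (i <= r)%N -> (i <= b i)%N.
Proof. by move=> ir; have := b_mono (i := 0%N) (j := i); rewrite b0 => /(_ ir). Qed.

(** The Newton polygon has only one edge, as [I] would split at an interior
    generator on or below the segment joining the two extreme ones. *)
Lemma staircase_above_diagonal i : (0 < i < r)%N ->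
  (b r * a 0%N < b r * a i + a 0%N * b i)%N.
Proof.
move=> ir; rewrite ltnNge; apply/negP => le_i.
pose w k := (b r * a k + a 0%N * b k)%N.
have [v [[k kr vE] vmin]] : exists v, (exists2 k, (0 < k < r)%N & v = w k) /\
    forall u, (exists2 k, (0 < k < r)%N & u = w k) -> (v <= u)%N.
  by apply: ex_least; exists (w i), i.
have v_le l : (l <= r)%N -> (v <= w l)%N.
  move=> lr; have vi : (v <= w i)%N by apply: vmin; exists i.
  have [l0|/eqP l0] := eqVneq l 0%N; first by subst l; rewrite /w b0; rewrite /w in vi; lia.
  have [lr'|/eqP lr'] := eqVneq l r; first by rewrite lr' /w ar; rewrite /w in vi; lia.
  by apply: vmin; exists l => //; lia.
have a0 : (0 < a 0%N)%N by have := a_mono (i := 0%N) (j := r); rewrite add0n ar; lia.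
have br : (0 < b r)%N by lia.
apply: (complete_split Icomplete I_mono br a0 (I_corner (k := k) _)) Isimple.
- by lia.
- move=> j l /I_monomial[n [nr aj bl]]; rewrite -/(w k) -vE.
  by apply: leq_trans (v_le n nr) _; apply: leq_add; rewrite leq_mul2l ?aj ?bl orbT.
- rewrite -[x ^+ _]mulr1 -[1](expr0 y) => /I_monomial[n [nr aj bl]].
  have n0 : n = 0%N by have := b_mono (i := 0%N) (j := n); rewrite add0n; lia.
  by have := a_mono (i := 0%N) (j := k); rewrite add0n; subst n; lia.
- rewrite -[y ^+ _]mul1r -[1](expr0 x) => /I_monomial[n [nr aj bl]].
  have := a_mono (i := n) (j := (r - n)%N); rewrite subnKC // => /(_ (leqnn _)).
  have := b_mono (i := k) (j := (r - k)%N); rewrite subnKC; last by lia.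
  move=> /(_ (leqnn _)); rewrite ar => h1 h2.
  have nr' : n = r by lia.
  by subst n; lia.
Qed.

Let pow_m i j n : (n <= i + j)%N -> ideal_pow m n (x ^+ i * y ^+ j).
Proof.
move=> nij; have -> : n = (minn i n + (n - minn i n))%N by lia.
have -> : x ^+ i * y ^+ j = x ^+ (i - minn i n) * y ^+ (j - (n - minn i n)) *
    (x ^+ minn i n * y ^+ (n - minn i n)).
  rewrite mulrACA -!exprD !subnK //; lia.
apply: idealM; first exact: ideal_pow_ideal.
by apply: ideal_pow_mul; [exact: (lmax_x hR) | exact: (lmax_y hR)].
Qed.

(** Otherwise [I] would be contained in [m^(r + 1)]. *)
Lemma staircase_order : exists2 k, (k <= r)%N & (a k + b k <= r)%N.
Proof.
apply: contrapT => nk; have [_ /(_ r.+1)] := Iord; rewrite ltnn => nI.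
suff : false by []; apply: nI; rewrite I_mono.
apply: mono_sub => [|_ _ [k kr [-> ->]]]; first exact: ideal_pow_ideal.
by apply: pow_m; rewrite ltnNge; apply/negP => akbk; apply: nk; exists k.
Qed.

(** A generator [k] of degree at most [r] satisfies [a k = r - k] and [b k = k],
    since both sequences are strictly monotone. An interior one would lie on or
    below the segment, because [r <= a 0 <= b r]; and if it is an extreme one, then
    [a 0 = r]. *)
Lemma staircase_a i : (i <= r)%N -> a i = (r - i)%N.
Proof.
have [k kr akbk] := staircase_order.
have a0r : a 0%N = r.
  have := a_mono (i := k) (j := (r - k)%N); rewrite subnKC // ar => /(_ (leqnn _)).
  have := b_mono (i := 0%N) (j := k); rewrite add0n b0 => /(_ kr).
  have := a_mono (i := 0%N) (j := r); rewrite add0n ar => /(_ (leqnn _)).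
  move=> a0r bk ak.
  have [k0|/eqP k0] := eqVneq k 0%N; first by subst k; lia.
  have [kr'|/eqP kr'] := eqVneq k r; first by subst k; lia.
  have := @staircase_above_diagonal k; have -> : a k = (r - k)%N by lia.
  have -> : b k = k by lia.
  by nia.
move=> ir; have := a_mono (i := 0%N) (j := i); rewrite add0n a0r => /(_ ir).
by have := a_mono (i := i) (j := (r - i)%N); rewrite subnKC // ar => /(_ (leqnn _)); lia.
Qed.

Let q := b r.

(** All generators lie on or above the segment joining the two extreme ones, and
    by completeness all lattice points on or above the segment are in [I]. *)
Lemma staircase_wt : I = wt x y q r (q * r).
Proof.
have a0r : a 0%N = r by rewrite staircase_a // subn0.
apply/seteqP; split.
  rewrite I_mono; apply: mono_sub => [|_ _ [k kr [-> ->]]]; first exact: wt_ideal.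
  apply: wt_monomial.
  have [->|/eqP k0] := eqVneq k 0%N; first by rewrite a0r leq_addr.
  have [->|/eqP kr'] := eqVneq k r; first by rewrite mulnC leq_addl.
  by have := @staircase_above_diagonal k; rewrite a0r -/q; lia.
apply: mono_sub => // i j ij.
have I0 : I (x ^+ r * y ^+ 0) by have := I_corner (leq0n r); rewrite a0r b0.
have Ir : I (x ^+ 0 * y ^+ q) by have := I_corner (leqnn r); rewrite ar.
have [ri|ir] := leqP r i.
  apply: (complete_convex (n := 1) (p := 0) Icomplete I0 Ir); lia.
have [d dE] : exists d, r = (d + i)%N by exists (r - i)%N; lia.
by apply: (complete_convex (n := i) (p := d) Icomplete I0 Ir); nia.
Qed.

(** A common divisor of the weights gives a lattice point in the interior of the
    edge. *)
Lemma staircase_coprime : coprime q r.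
Proof.
have a0r : a 0%N = r by rewrite staircase_a // subn0.
have q0 : (0 < q)%N.
  by have := b_mono (i := 0%N) (j := r); rewrite add0n => /(_ (leqnn _)); rewrite /q; lia.
have /dvdnP[q' qE] := dvdn_gcdl q r; have /dvdnP[r' rE] := dvdn_gcdr q r.
rewrite /coprime; move: qE rE; set d := gcdn q r => qE rE.
have [d1|d1] := leqP d 1; first by apply/eqP; nia.
have : I (x ^+ (r - r') * y ^+ q').
  rewrite staircase_wt; apply: wt_monomial; rewrite mulnBr; nia.
have r'0 : (0 < r')%N by nia.
have q'0 : (0 < q')%N by nia.
have q'q : (q' < q)%N by nia.
have r'r : (r' <= r)%N by nia.
move=> /I_monomial[k [kr ak bk]].
have [k0|/eqP k0] := eqVneq k 0%N; first by subst k; lia.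
have [kr'|/eqP kr'] := eqVneq k r; first by subst k; rewrite /q in q'q; lia.
have kin : (0 < k < r)%N by lia.
have := staircase_above_diagonal kin; rewrite -/q a0r.
have : (q * a k + r * b k <= q * (r - r') + r * q')%N.
  by apply: leq_add; rewrite leq_mul2l ?ak ?bk orbT.
rewrite mulnBr; have -> : (r * q' = q * r')%N by rewrite {1}rE qE; lia.
rewrite subnK ?leq_mul2l ?r'r ?orbT //; lia.
Qed.

Lemma staircase_q : (r < q)%N.
Proof.
have rq : (r <= q)%N.
  by have := b_mono (i := 0%N) (j := r); rewrite add0n b0 => /(_ (leqnn _)).
rewrite ltn_neqAle rq andbT; apply/eqP => rq'.
by move: staircase_coprime; rewrite -rq' /coprime gcdnn => /eqP; lia.
Qed.

End Staircase.

End CompleteMonomial.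

(** Coprime weights have multiples that differ by [1], so the value group is the
    whole group of integers. *)
Lemma wt_filtration (R : idomainType) (m : set R) (x y : R) (al be : nat) :
  regular_local2 m x y -> (0 < al)%N -> (0 < be)%N -> coprime al be ->
  valuation_filtration (wt x y al be).
Proof.
move=> hR al0 be0 cop; split.
- exact: wt_ideal.
- by move=> n; apply: wt_anti.
- exact: wt0.
- by move=> n p z w; apply: wt_mul.
- by move=> n p z w; apply: (wt_mul_exact hR).
- by move=> z z0; apply: (wt_separated hR).
have [u v uvE _] := egcdnP be al0; move: uvE; rewrite (eqP cop) => uvE.
exists (be * v)%N, (x ^+ 0 * y ^+ v), (x ^+ u * y ^+ 0).
split; first by apply: wt_monomial; lia.
- by move=> /(mono_monomial hR)[i [j [+ i0 jv]]]; nia.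
- by apply: wt_monomial; lia.
- by move=> /(mono_monomial hR)[i [j [+ iu j0]]]; nia.
Qed.

(** * The associated module *)

Section AssociatedModule.
Variables (R : idomainType) (m : set R) (x y : R).
Hypothesis hR : regular_local2 m x y.
Variable e : nat.

(** The linear form [R^e -> R] that kills the generators [g_i] of [M]; its
    coefficients are, up to sign, the monomials of degree [e - 1]. *)
Definition minor_coef (k : nat) : R := (- y) ^+ k * x ^+ (e.-1 - k).

Definition minor_form (v : 'cV[R]_e) : R := \sum_(k < e) minor_coef k * v k ord0.

Lemma minor_form_lin c u v :
  minor_form (c *: u + v) = c * minor_form u + minor_form v.
Proof.
rewrite /minor_form mulr_sumr -big_split /=; apply: eq_bigr => k _.
by rewrite !mxE; ring.
Qed.

Lemma minor_form0 : minor_form 0 = 0.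
Proof. by rewrite /minor_form big1 // => k _; rewrite mxE mulr0. Qed.

Lemma minor_formD u v : minor_form (u + v) = minor_form u + minor_form v.
Proof. by rewrite -{1}[u]scale1r minor_form_lin mul1r. Qed.

Lemma minor_formZ c u : minor_form (c *: u) = c * minor_form u.
Proof. by rewrite -[c *: u]addr0 minor_form_lin minor_form0 addr0. Qed.

Lemma minor_formB u v : minor_form (u - v) = minor_form u - minor_form v.
Proof. by rewrite minor_formD -scaleN1r minor_formZ mulN1r. Qed.

Lemma minor_form_eps i : (i < e)%N -> minor_form (eps R e i.+1) = minor_coef i.
Proof.
move=> ie; rewrite /minor_form (bigD1 (Ordinal ie)) //= mxE eqxx mulr1 big1 ?addr0 //.
move=> k /eqP ki; rewrite mxE eqSS; case: eqP => [E|]; last by rewrite mulr0.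
by case: ki; apply: val_inj.
Qed.

(** The generator [g_i] of the module. *)
Definition koszul_rel i : 'cV[R]_e := y *: eps R e i + x *: eps R e i.+1.

Lemma minor_form_koszul_rel i : (0 < i < e)%N -> minor_form (koszul_rel i) = 0.
Proof.
case: i => // i /andP[_ ie]; rewrite /koszul_rel minor_formD !minor_formZ.
rewrite !minor_form_eps // ?(ltnW ie) // /minor_coef.
have -> : (e.-1 - i = (e.-1 - i.+1).+1)%N by lia.
by rewrite !exprS; ring.
Qed.

(** The kernel of [minor_form] is generated by the [g_i]: a relation whose last
    nonzero coordinate is the [t]-th has that coordinate divisible by [x]. *)
Lemma minor_form_kernel (A : set 'cV[R]_e) v : (0 < e)%N -> submodule A ->
  (forall i, (0 < i < e)%N -> A (koszul_rel i)) -> minor_form v = 0 -> A v.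
Proof.
move=> e_gt0 Am Ag.
suff H t : (0 < t <= e)%N -> forall v : 'cV_e, (forall k : 'I_e, (t <= k)%N -> v k ord0 = 0) ->
    minor_form v = 0 -> A v.
  by apply: (H e); [lia | move=> k; rewrite leqNgt ltn_ord].
elim: t => // -[_ /= e0|t IHt] /=.
  move=> u u0 fu0; suff -> : u = 0 by exact: submodule0.
  have uz : u (Ordinal e0) ord0 = 0.
    move: fu0; rewrite /minor_form (bigD1 (Ordinal e0)) //= big1 ?addr0 => [|k kn0]; last first.
      by rewrite u0 ?mulr0 // lt0n; apply: contra_neq kn0 => k0; apply: val_inj.
    rewrite /minor_coef mul1r => /eqP.
    by rewrite mulf_eq0 expf_eq0 (negPf (param_neq0 hR)) andbF => /eqP.
  apply/matrixP => k j; rewrite ord1 mxE; have [k0|k0] := posnP k; last exact: u0.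
  by rewrite -uz; congr (u _ _); apply: val_inj.
move=> te u u0 fu0; set p := Ordinal te; set w := u p ord0.
have [s wE] : exists s, w = s * x.
  have [c cE] : principal (x ^+ (e.-1 - t.+1) * x) (minor_coef p * w).
    have -> : minor_coef p * w = - \sum_(k < e | k != p) minor_coef k * u k ord0.
      by apply/eqP; rewrite -addr_eq0; move: fu0; rewrite /minor_form (bigD1 p) //= => /eqP.
    have xi := principal_ideal (x ^+ (e.-1 - t.+1) * x).
    apply: (idealN xi); apply: (ideal_sum _ xi) => k kp.
    have [kt|tk] := ltnP k t.+1; last first.
      rewrite u0 ?mulr0; first exact: ideal0.
      by rewrite ltn_neqAle tk andbT; apply: contra_neq kp => kt; apply: val_inj.
    exists ((- y) ^+ k * x ^+ (t - k) * u k ord0); rewrite /minor_coef.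
    have -> : (e.-1 - k = t - k + (e.-1 - t.+1).+1)%N by lia.
    by rewrite exprD exprS; ring.
  have [|d dE] := @regular_seq_pow _ _ _ _ hR 1 t.+1 ((-1) ^+ t.+1 * w) c.
    apply: (mulIf (expf_neq0 (e.-1 - t.+1) (param_neq0 hR))).
    transitivity (minor_coef p * w); last by rewrite cE; ring.
    by rewrite /minor_coef /= [(- y) ^+ _]exprNn; ring.
  exists ((-1) ^+ t.+1 * d); rewrite -mulrA -[d * x]dE mulrA -exprMn mulrNN mulr1.
  by rewrite expr1n mul1r.
rewrite -[u](subrK (s *: koszul_rel t.+1)).
have Ak : A (koszul_rel t.+1) by apply: Ag; lia.
apply: submoduleD => //; last exact: submoduleZ.
apply: IHt; first by lia.
  move=> k tk; rewrite /koszul_rel !mxE (_ : (k.+1 == t.+1) = false); last by apply/eqP; lia.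
  rewrite eqSS mulr0 add0r; have [kt|kt] := eqVneq (k : nat) t.+1.
    have -> : k = p by apply: val_inj.
    by rewrite -/w wE mulr1 subrr.
  by rewrite u0 ?mulr0 ?subr0 // ltn_neqAle eq_sym kt.
by rewrite minor_formB minor_formZ minor_form_koszul_rel ?mulr0 ?subr0 //; lia.
Qed.

Variables (I : set R) (r : nat) (a b : nat -> nat).
Hypotheses (e_gt1 : (1 < e)%N) (er : (e <= r)%N).
Hypothesis IE : I = ideal_gen [set x ^+ a i * y ^+ b i | i in [set i | (i <= r)%N]].
Hypotheses (aE : forall i, (i <= r)%N -> a i = (r - i)%N).
Hypotheses (b_ge : forall i, (i <= r)%N -> (i <= b i)%N).

Local Notation M := (assoc_module x y r a b e).

Lemma assoc_koszul_rel i : (0 < i < e)%N -> M (koszul_rel i).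
Proof.
by move=> ie; apply: submod_span_gen; left; right; exists i => //=; lia.
Qed.

Lemma assoc_submodule : submodule M.
Proof. exact: submod_span_submodule. Qed.

Let I_ideal : ideal I. Proof. rewrite IE; exact: ideal_gen_ideal. Qed.

Let I_corner k : (k <= r)%N -> I (x ^+ a k * y ^+ b k).
Proof. by move=> kr; rewrite IE; apply: ideal_gen_gen; exists k. Qed.

Lemma minor_form_f i : (i <= r - e + 1)%N ->
  minor_form ((x ^+ (a i + 1 - e) * y ^+ b i) *: eps R e 1) = x ^+ a i * y ^+ b i.
Proof.
move=> ir; rewrite minor_formZ minor_form_eps; last by lia.
rewrite /minor_coef expr0 mul1r subn0 mulrAC -exprD; congr (x ^+ _ * _).
rewrite aE; lia.
Qed.

Lemma minor_form_h i : (0 < i < e)%N ->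
  minor_form (y ^+ (b (r - e + 1 + i) - i) *: eps R e i.+1) =
  (-1) ^+ i * (x ^+ a (r - e + 1 + i) * y ^+ b (r - e + 1 + i)).
Proof.
move=> ie; rewrite minor_formZ minor_form_eps; last by lia.
have kr : (r - e + 1 + i <= r)%N by lia.
have ib : (i <= b (r - e + 1 + i))%N by apply: leq_trans (b_ge kr); lia.
have -> : y ^+ b (r - e + 1 + i) = y ^+ (b (r - e + 1 + i) - i) * y ^+ i by rewrite -exprD subnK.
rewrite /minor_coef aE // [(- y) ^+ _]exprNn.
have -> : (r - (r - e + 1 + i) = e.-1 - i)%N by lia.
by ring.
Qed.

(** The [f_i] and the [h_i] lift the monomial generators of [I]. *)
Lemma minor_form_onto z : I z -> exists2 w, M w & minor_form w = z.
Proof.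
suff : I `<=` [set z | exists2 w, M w & minor_form w = z] by apply.
have Mm := assoc_submodule.
rewrite {1}IE; apply: ideal_gen_sub.
  apply/idealP; split; first by exists 0; [exact: submodule0 | exact: minor_form0].
  move=> c _ _ [u Mu <-] [v Mv <-]; exists (c *: u + v); last exact: minor_form_lin.
  by apply: (submoduleD Mm) => //; apply: (submoduleZ _ Mm).
move=> _ [k kr <-]; have [ks|sk] := leqP k (r - e + 1).
  eexists; last exact: minor_form_f ks.
  by apply: submod_span_gen; left; left; exists k.
have ie : (0 < k - (r - e + 1) < e)%N by move: kr => /=; lia.
have kE : (r - e + 1 + (k - (r - e + 1)) = k)%N by lia.
move: (minor_form_h ie); set i := (k - _)%N in ie kE *; rewrite kE => fE.
exists ((-1) ^+ i *: (y ^+ (b k - i) *: eps R e i.+1)).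
  apply: (submoduleZ _ Mm); apply: submod_span_gen; right; exists i => //=; last by rewrite kE.
  lia.
by rewrite minor_formZ fE mulrA -exprMn mulrNN mulr1 expr1n mul1r.
Qed.

(** The module is the preimage of the ideal: [R^e / M] is isomorphic to
    [m^(e - 1) / I]. *)
Lemma assoc_moduleE : M = [set v | I (minor_form v)].
Proof.
apply/seteqP; split=> [|v Iv].
  apply: submod_span_sub.
    apply/submoduleP; split; first by rewrite /= minor_form0; exact: ideal0.
    by move=> c u v /= Iu Iv; rewrite minor_form_lin; apply: idealD => //; apply: idealM.
  move=> _ [[[i /= ir <-]|[i /= ie <-]]|[i /= ie <-]].
  - by rewrite /= minor_form_f //; apply: I_corner; lia.
  - rewrite /= -/(koszul_rel i) minor_form_koszul_rel; [exact: ideal0 | lia].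
  - rewrite /= minor_form_h; last by lia.
    by apply: idealM => //; apply: I_corner; lia.
have [w Mw wE] := minor_form_onto Iv.
have Mm := assoc_submodule.
rewrite -[v](subrK w); apply: (submoduleD Mm) => //.
apply: (minor_form_kernel (ltnW e_gt1) Mm assoc_koszul_rel).
by rewrite minor_formB wE subrr.
Qed.

End AssociatedModule.

(** * Rank and integral closedness *)

Lemma dvr_closed (R : idomainType) (V : set {fraction R}) : dvr V ->
  V 0 /\ forall c f g, V c -> V f -> V g -> V (c * f + g).
Proof.
move=> [v [vM vD _] ->]; split; first by left.
have VM f g : f = 0 \/ 0 <= v f -> g = 0 \/ 0 <= v g -> f * g = 0 \/ 0 <= v (f * g).
  have [->|f0] := eqVneq f 0; first by rewrite mul0r; left.
  have [->|g0] := eqVneq g 0; first by rewrite mulr0; left.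
  move=> [/eqP|vf]; first by rewrite (negPf f0).
  move=> [/eqP|vg]; first by rewrite (negPf g0).
  by right; rewrite vM // addr_ge0.
move=> c f g /= Vc Vf Vg; have := VM _ _ Vc Vf; move: (c * f) => h Vh.
have [->|h0] := eqVneq h 0; first by rewrite add0r.
have [->|g0] := eqVneq g 0; first by rewrite addr0.
have [->|hg0] := eqVneq (h + g) 0; first by left.
right; have := vD h g h0 g0 hg0.
case: Vh => [/eqP|vh]; first by rewrite (negPf h0).
case: Vg => [/eqP|vg]; first by rewrite (negPf g0).
by apply: le_trans; rewrite Order.TotalTheory.le_min vh.
Qed.

Section Conclusions.
Variables (R : idomainType) (m : set R) (x y : R).
Hypothesis hR : regular_local2 m x y.
Variables (q r e : nat).
Hypotheses (r_gt0 : (0 < r)%N) (rq : (r < q)%N) (cop : coprime q r).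
Local Notation K := {fraction R}.
Local Notation "z %:F" := (@tofrac R z).

(** The complete ideal of the monomial valuation [v] with [v x = q] and
    [v y = r]. *)
Local Notation I := (wt x y q r (q * r)).

Definition wt_module : set 'cV[R]_e := [set v | I (minor_form x y v)].

Lemma wt_module_submodule : submodule wt_module.
Proof.
have Ii := wt_ideal x y q r (q * r).
apply/submoduleP; split; first by rewrite /wt_module /= minor_form0; exact: ideal0.
move=> c u v Mu Mv; rewrite /wt_module /= minor_form_lin.
by apply: (idealD Ii) => //; apply: (idealM _ Ii).
Qed.

Lemma wt_x : I (x ^+ r).
Proof. by rewrite -[x ^+ r]mulr1 -[1](expr0 y); apply: wt_monomial; rewrite leq_addr. Qed.

Lemma wt_y : I (y ^+ q).
Proof.
rewrite -[y ^+ q]mul1r -[1](expr0 x); apply: wt_monomial.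
by rewrite [(q * r)%N]mulnC leq_addl.
Qed.

Lemma wt_module_scale z v : I z -> wt_module (z *: v).
Proof.
move=> Iz; rewrite /wt_module /= minor_formZ mulrC.
exact: (idealM _ (wt_ideal _ _ _ _ _) Iz).
Qed.

Lemma wt_module_rank : module_rank wt_module e.
Proof.
exists fullv; split; last by rewrite dimvf /dim /= muln1.
apply/seteqP; split=> [v _|v _]; first by rewrite /= memvf.
have x0 : (x ^+ r)%:F != 0 by rewrite tofrac_eq0 expf_neq0 ?(param_neq0 hR).
have Sm := submod_span_submodule (@fracv R e @` wt_module).
rewrite [v]matrix_sum_delta; apply: (submodule_sum _ Sm) => k _.
apply: (submodule_sum _ Sm) => j _; apply: (submoduleZ _ Sm).
have -> : delta_mx k j = (x ^+ r)%:F^-1 *: fracv (x ^+ r *: delta_mx k j) :> 'cV[K]_e.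
  apply/matrixP => k' j'; rewrite !mxE tofracM mulKf //.
  by case: (_ && _); rewrite /= ?tofrac1 ?tofrac0.
apply: (submoduleZ _ Sm); apply: submod_span_gen.
by exists (x ^+ r *: delta_mx k j) => //; apply: wt_module_scale wt_x.
Qed.

(** An integral element has its coordinates in every discrete valuation ring
    over [R], hence in [R]; as [minor_form] maps [M V] into [I V], it is mapped
    by [minor_form] to an element of value at least [q * r] for the monomial
    valuation, that is into [I]. *)
Lemma wt_module_integrally_closed : integrally_closed wt_module.
Proof.
apply/seteqP; split; last first.
  move=> _ [u Mu <-]; split; first by apply: submod_span_gen; exists u.
  by move=> V _ _; apply: sub_gen_smallest; exists u.
move=> f [_ fV].
have /choice[z zE] k : exists z, f k ord0 = z%:F.
  apply: (in_all_dvr hR) => V Vdvr RV.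
  have [V0 Vl] := dvr_closed Vdvr.
  suff sub : extend_module V wt_module `<=` [set u | forall k, V (u k ord0)].
    exact: sub (fV V Vdvr RV) k.
  apply: smallest_sub; last by move=> _ [u _ <-] j; rewrite mxE; apply: RV; exists (u j ord0).
  split=> [j|c u w Vc Vu Vw j]; first by rewrite mxE.
  by rewrite !mxE; apply: Vl.
set u : 'cV[R]_e := \col_k z k.
have fE : f = fracv u by apply/matrixP => k j; rewrite ord1 !mxE zE.
exists u => //; rewrite /wt_module /=.
have vF := wt_filtration hR (ltn_trans r_gt0 rq) r_gt0 cop.
have [V [Vdvr RV VP]] := filtration_dvr vF.
have [V0 Vl] := dvr_closed Vdvr.
have x0 : x ^+ r != 0 by rewrite expf_neq0 ?(param_neq0 hR).
pose phi (w : 'cV[K]_e) : K := \sum_(k < e) (minor_coef x y e k)%:F * w k ord0.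
have phiE w : phi (fracv w) = (minor_form x y w)%:F.
  by rewrite /phi /minor_form rmorph_sum; apply: eq_bigr => k _; rewrite mxE rmorphM.
suff sub : extend_module V wt_module `<=` [set w | V (phi w / (x ^+ r)%:F)].
  have := sub f (fV V Vdvr RV); rewrite /= fE phiE => /(VP _ _ x0); apply.
  exact: wt_x.
apply: smallest_sub.
  split=> [|c w w' Vc /= Vw Vw'].
    by rewrite /= /phi big1 ?mul0r // => k _; rewrite mxE mulr0.
  have -> : phi (c *: w + w') = c * phi w + phi w'.
    by rewrite /phi mulr_sumr -big_split; apply: eq_bigr => k _; rewrite /= !mxE; ring.
  by rewrite mulrDl -mulrA; apply: Vl.
move=> _ [w Mw <-]; rewrite /= phiE; apply/VP => // n nx.
apply: wt_anti Mw; move: nx; rewrite -[x ^+ r]mulr1 -[1](expr0 y).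
move=> /(mono_monomial hR)[i [j [+ ir]]]; rewrite leqn0 => + /eqP j0.
by rewrite j0 muln0 addn0 => /leq_trans; apply; rewrite leq_mul2l ir orbT.
Qed.

(** * Indecomposability *)

Lemma det_congr (J : set R) n (A B : 'M[R]_n) : ideal J ->
  (forall i j, J (A i j - B i j)) -> J (\det A - \det B).
Proof.
move=> Ji AB; rewrite /determinant -sumrB; apply: (ideal_sum _ Ji) => s _.
rewrite -mulrBr; apply: (idealM _ Ji).
apply: (big_ind2 (fun u v => J (u - v))) => [|u u' v v' Juu Jvv|i _ //].
  by rewrite subrr; exact: ideal0.
have -> : u * v - u' * v' = v * (u - u') + u' * (v - v') by ring.
by apply: (idealD Ji); apply: (idealM _ Ji).
Qed.

(** [1 - Q] is unitriangular modulo [m], so it is invertible, and it kills [Q]. *)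
Lemma idempotent_eq0 n (Q : 'M[R]_n) : Q *m Q = Q ->
  (forall k l : 'I_n, (l <= k)%N -> m (Q k l)) -> Q = 0.
Proof.
move=> QQ Qm.
pose U : 'M[R]_n := \matrix_(k, l) (if (l < k)%N then 0 else if l == k then 1 else (1%:M - Q) k l).
have detU : \det U = 1.
  rewrite -det_tr det_trig; last by apply/is_trig_mxP => k l kl; rewrite !mxE kl.
  by rewrite big1 // => k _; rewrite !mxE ltnn eqxx.
have mi := lmax_ideal hR.
have mdet : m (\det (1%:M - Q) - 1).
  rewrite -[X in _ - X]detU; apply: (det_congr mi) => k l; rewrite !mxE.
  have [lk|kl] := ltnP l k.
    rewrite subr0 (_ : (k == l) = false) ?sub0r; last by apply/eqP => kl; move: lk; rewrite kl ltnn.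
    by apply: (idealN mi); apply: Qm; rewrite ltnW.
  have [->|lk] := eqVneq l k; last by rewrite subrr; exact: ideal0.
  by rewrite ?eqxx mulr1n addrAC subrr sub0r; apply: (idealN mi); apply: Qm.
have [|u u1] := @notin_lmax_unit _ _ _ _ hR (\det (1%:M - Q)).
  move=> md; apply: (lmax1 hR); have := idealB mi md mdet.
  by rewrite opprB addrC subrK.
rewrite -[Q]scale1r -u1 -scalerA -[_ *: Q]mul_scalar_mx -mul_adj_mx -mulmxA.
by rewrite mulmxBl mul1mx QQ subrr mulmx0 scaler0.
Qed.

End Conclusions.

Section Indecomposable.
Variables (R : idomainType) (m : set R) (x y : R).
Hypothesis hR : regular_local2 m x y.
Variables (q r n : nat).
Hypotheses (rq : (r < q)%N) (nr : (n < r)%N).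
Local Notation I := (wt x y q r (q * r)).
Local Notation M := (@wt_module R x y q r n.+1).
Let mi := lmax_ideal hR.

(** Comparison of the coefficients of the monomials of degree [n + 1] other than
    [x^(n + 1)], none of which lies in [I]. *)
Lemma linear_part_coef (u v : 'cV[R]_n.+1) (j : nat) : (j <= n)%N ->
  M (y *: u + x *: v) ->
  m (u (inord j) ord0 - (if (j < n)%N then v (inord j.+1) ord0 else 0)).
Proof.
move=> jn; rewrite /wt_module /= minor_formD !minor_formZ => Iuv.
pose S i l := ((n - j < i) \/ (j.+1 < l))%N.
have Si := mono_ideal x y S.
set mu := x ^+ (n - j) * y ^+ j.+1.
set w := if _ then _ else _.
have Su : mono x y S (y * minor_form x y u - (-1) ^+ j * u (inord j) ord0 * mu).
  rewrite /minor_form (bigD1 (inord j)) //= mulrDr addrAC.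
  rewrite {1}/minor_coef /= inordK // [(- y) ^+ _]exprNn.
  have -> : y * ((-1) ^+ j * y ^+ j * x ^+ (n - j) * u (inord j) ord0)
    - (-1) ^+ j * u (inord j) ord0 * mu = 0 by rewrite /mu exprS; ring.
  rewrite add0r mulr_sumr; apply: (ideal_sum _ Si) => k /eqP kj.
  have kj' : k <> j :> nat by move=> kj'; apply: kj; rewrite -kj' inord_val.
  have kn := ltn_ord k.
  have -> : y * (minor_coef x y n.+1 k * u k ord0) =
      (-1) ^+ k * u k ord0 * (x ^+ (n - k) * y ^+ k.+1).
    by rewrite /minor_coef /= [(- y) ^+ _]exprNn exprS; ring.
  by apply: (idealM _ Si); apply: mono_gen; rewrite /S; lia.
have Bk k : (k <= n)%N -> forall c, x * (minor_coef x y n.+1 k * c) =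
      (-1) ^+ k * c * (x ^+ (n.+1 - k) * y ^+ k).
  move=> kn c; rewrite /minor_coef /= [(- y) ^+ _]exprNn subSn // exprS; ring.
have Sv : mono x y S (x * minor_form x y v + (-1) ^+ j * w * mu).
  have Sk (k : 'I_n.+1) : k <> j.+1 :> nat ->
      mono x y S (x * (minor_coef x y n.+1 k * v k ord0)).
    move=> kj; have kn := ltn_ord k; rewrite Bk //.
    by apply: (idealM _ Si); apply: mono_gen; rewrite /S; lia.
  rewrite /w; case: ifP => [jn'|jn'].
    rewrite /minor_form (bigD1 (inord j.+1)) //= mulrDr addrAC.
    rewrite inordK // Bk // subSS.
    have -> : (-1) ^+ j.+1 * v (inord j.+1) ord0 * (x ^+ (n - j) * y ^+ j.+1)
      + (-1) ^+ j * v (inord j.+1) ord0 * mu = 0 by rewrite /mu exprS; ring.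
    rewrite add0r mulr_sumr; apply: (ideal_sum _ Si) => k /eqP kj.
    by apply: Sk => kj'; apply: kj; rewrite -kj' inord_val.
  rewrite mulr0 mul0r addr0 /minor_form mulr_sumr; apply: (ideal_sum _ Si) => k _.
  by apply: Sk; have := ltn_ord k; lia.
have SI : mono x y S (y * minor_form x y u + x * minor_form x y v).
  move: Iuv; apply: (mono_sub Si) => i l il; apply: mono_gen; rewrite /S.
  have [|ij] := ltnP (n - j) i; first by left.
  by have [|lj] := ltnP j.+1 l; [right | nia].
have : m ((-1) ^+ j * (u (inord j) ord0 - w)).
  apply: (@mono_coef _ _ _ _ hR S (n - j) j.+1) => //; rewrite -/mu.
  have -> : (-1) ^+ j * (u (inord j) ord0 - w) * mu =
     (y * minor_form x y u + x * minor_form x y v)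
     - (y * minor_form x y u - (-1) ^+ j * u (inord j) ord0 * mu)
     - (x * minor_form x y v + (-1) ^+ j * w * mu) by ring.
  by apply: (idealB Si) => //; apply: (idealB Si).
move/(idealM ((-1) ^+ j) mi).
by rewrite mulrA -exprMn mulrNN mulr1 expr1n mul1r.
Qed.

Lemma wt_module_koszul_rel i : (0 < i < n.+1)%N -> M (koszul_rel x y n.+1 i).
Proof.
move=> ie; rewrite /wt_module /= minor_form_koszul_rel //.
exact: ideal0 (wt_ideal _ _ _ _ _).
Qed.

(** Modulo [m], an endomorphism of [M] is an upper triangular Toeplitz matrix:
    it preserves the span of the linear forms [y eps_i + x eps_(i+1)] up to a
    multiple of [x eps_1]. *)
Lemma endo_toeplitz (P : 'M[R]_n.+1) : (forall v, M v -> M (P *m v)) ->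
  forall j l, (j <= n)%N -> (l < n)%N ->
  m (P (inord j) (inord l) - (if (j < n)%N then P (inord j.+1) (inord l.+1) else 0)).
Proof.
move=> PM j l jn ln.
have : M (P *m koszul_rel x y n.+1 l.+1) by apply: PM; apply: wt_module_koszul_rel.
rewrite /koszul_rel mulmxDr -!scalemxAr => /(linear_part_coef jn).
have Peps k i : (i <= n)%N -> (P *m eps R n.+1 i.+1) k ord0 = P k (inord i).
  move=> i_n; rewrite mxE (bigD1 (inord i)) //= mxE inordK // eqxx mulr1 big1 ?addr0 //.
  move=> k' /eqP ki; rewrite mxE eqSS; case: eqP => [E|]; last by rewrite mulr0.
  by case: ki; rewrite -E inord_val.
by rewrite !Peps // ltnW.
Qed.

(** Following a diagonal below the main one leads to the last row, where the
    entries are in [m]. *)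
Lemma endo_lower (P : 'M[R]_n.+1) : (forall v, M v -> M (P *m v)) ->
  forall k l : 'I_n.+1, (l < k)%N -> m (P k l).
Proof.
move=> PM k l lk; rewrite -[k]inord_val -[l]inord_val.
have : (k <= n)%N by rewrite -ltnS.
move: (k : nat) (l : nat) lk => {l}k {}l lk kn.
have [d dE] : exists d, (k + d = n)%N by exists (n - k)%N; lia.
elim: d k l lk kn dE => [|d IHd] k l lk kn dE.
  have ln : (l < n)%N by lia.
  by have := endo_toeplitz PM kn ln; rewrite ltnNge (_ : n <= k)%N ?subr0 //; lia.
have ln : (l < n)%N by lia.
have kn' : (k < n)%N by lia.
have := endo_toeplitz PM kn ln; rewrite kn' => mP.
rewrite -[P _ _](subrK (P (inord k.+1) (inord l.+1))); apply: (idealD mi) => //.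
by apply: IHd; lia.
Qed.

Lemma endo_diag (P : 'M[R]_n.+1) : (forall v, M v -> M (P *m v)) ->
  forall k : 'I_n.+1, m (P k k - P ord0 ord0).
Proof.
move=> PM k; rewrite -[k]inord_val -[ord0]inord_val /=.
have : (k <= n)%N by rewrite -ltnS.
elim: (k : nat) => [_|{}k IHk kn]; first by rewrite subrr; exact: ideal0.
have := endo_toeplitz PM (ltnW kn) kn; rewrite kn => mP.
have -> : P (inord k.+1) (inord k.+1) - P (inord 0) (inord 0) =
  (P (inord k) (inord k) - P (inord 0) (inord 0)) -
  (P (inord k) (inord k) - P (inord k.+1) (inord k.+1)) by ring.
by apply: (idealB mi) => //; apply: IHk; apply: ltnW.
Qed.

(** Modulo [m], the constant on the diagonal of [P] is idempotent; according to
    whether it is [0] or [1], [idempotent_eq0] applies to [P] or to [1 - P]. *)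
Lemma idempotent_endo (P : 'M[R]_n.+1) : (forall v, M v -> M (P *m v)) ->
  P *m P = P -> P = 0 \/ P = 1%:M.
Proof.
move=> PM PP.
have m00 : m (P ord0 ord0 * (1 - P ord0 ord0)).
  have -> : P ord0 ord0 * (1 - P ord0 ord0) =
      \sum_(k < n.+1 | k != ord0) P ord0 k * P k ord0.
    have := congr1 (fun A : 'M_n.+1 => A ord0 ord0) PP; rewrite /= mxE (bigD1 ord0) //=.
    by move=> E; apply/eqP; rewrite mulrBr mulr1 subr_eq addrC E.
  apply: (ideal_sum _ mi) => k k0; apply: (idealM _ mi); apply: endo_lower => //.
  by rewrite lt0n; apply: contra_neq k0 => k0; apply: val_inj.
have [m0|m1] := lmax_prime hR m00; [left|right].
  apply: (idempotent_eq0 hR PP) => k l.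
  rewrite leq_eqVlt => /predU1P[/val_inj->|]; last exact: endo_lower.
  by rewrite -[P k k](subrK (P ord0 ord0)); apply: (idealD mi) => //; apply: endo_diag.
apply/eqP; rewrite eq_sym -subr_eq0; apply/eqP; apply: (idempotent_eq0 hR).
  by rewrite mulmxBl mul1mx mulmxBr mulmx1 PP subrr subr0.
move=> k l; rewrite leq_eqVlt => /predU1P[/val_inj->|lk]; rewrite !mxE.
  rewrite eqxx; have -> : 1 - P k k = (1 - P ord0 ord0) - (P k k - P ord0 ord0) by ring.
  by apply: (idealB mi) => //; apply: endo_diag.
rewrite (_ : (k == l) = false) ?sub0r; last by apply/eqP => kl; move: lk; rewrite kl ltnn.
by apply: (idealN mi); apply: endo_lower.
Qed.

(** The projection onto a direct summand of [M] extends to [R^(n + 1)], because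
    [x^r] and [y^q] multiply [R^(n + 1)] into [M] and form a regular sequence;
    it is an idempotent endomorphism of [M]. *)
Lemma wt_module_indecomposable : indecomposable M.
Proof.
have xr0 : x ^+ r != 0 by rewrite expf_neq0 ?(param_neq0 hR).
have scale0 u : x ^+ r *: u = 0 -> u = 0 :> 'cV[R]_n.+1.
  by move=> /eqP; rewrite scalemx_eq0 (negPf xr0) => /eqP.
split=> [M0|M1 M2 S1 S2 ME M12].
  have : M (x ^+ r *: delta_mx ord0 ord0) by apply: wt_module_scale; apply: wt_x.
  rewrite M0 => /scale0 /matrixP /(_ ord0 ord0) /eqP.
  by rewrite !mxE !eqxx oner_eq0.
have Msum u : M u -> exists u1 u2, [/\ M1 u1, M2 u2 & u = u1 + u2].
  by rewrite ME => -[u1 M1u [u2 M2u <-]]; exists u1, u2.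
have direct u1 u2 : M1 u1 -> M2 u2 -> u1 + u2 = 0 -> u1 = 0.
  move=> M1u M2u /eqP; rewrite addr_eq0 => /eqP u12.
  suff : (M1 `&` M2) u1 by rewrite M12.
  by split=> //; rewrite u12; apply: (submoduleN S2).
pose d j : 'cV[R]_n.+1 := delta_mx j ord0.
have dsum (v : 'cV[R]_n.+1) : v = \sum_j v j ord0 *: d j.
  by rewrite {1}[v]matrix_sum_delta; apply: eq_bigr => j _; rewrite big_ord1.
have /choice[p pP] j : exists p : 'cV[R]_n.+1,
    M1 (x ^+ r *: p) /\ M2 (x ^+ r *: d j - x ^+ r *: p).
  have [|u [u' [M1u M2u' uE]]] := Msum (x ^+ r *: d j).
    by apply: wt_module_scale; apply: wt_x.
  have [|w [w' [M1w M2w' wE]]] := Msum (y ^+ q *: d j).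
    by apply: wt_module_scale; apply: wt_y.
  have uw : y ^+ q *: u - x ^+ r *: w = 0.
    apply: (direct _ (y ^+ q *: u' - x ^+ r *: w')).
    - by apply: (submoduleB S1); apply: submoduleZ.
    - by apply: (submoduleB S2); apply: submoduleZ.
    by rewrite addrACA -scalerDr -uE -opprD -scalerDr -wE !scalerA mulrC subrr.
  have /choice[c cE] k : exists c, u k ord0 = c * x ^+ r.
    apply: (@regular_seq_pow _ _ _ _ hR r q _ (w k ord0)); rewrite mulrC [RHS]mulrC.
    move/matrixP/(_ k ord0): uw; rewrite !mxE => /eqP; rewrite subr_eq0 => /eqP <-.
    by rewrite mulrC.
  have pE : x ^+ r *: (\col_k c k) = u by apply/matrixP => k l; rewrite ord1 !mxE cE mulrC.
  by exists (\col_k c k); rewrite pE; split=> //; rewrite uE addrC addKr.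
pose P : 'M[R]_n.+1 := \matrix_(k, j) p j k ord0.
have Pd j : P *m d j = p j.
  by rewrite -colE; apply/matrixP => k l; rewrite ord1 !mxE.
have proj u1 u2 : M1 u1 -> M2 u2 -> P *m (u1 + u2) = u1.
  move=> M1u M2u; set v := u1 + u2.
  have Pv : P *m v = \sum_j v j ord0 *: p j.
    by rewrite {1}[v]dsum mulmx_sumr; apply: eq_bigr => j _; rewrite -scalemxAr Pd.
  have M1Pv : M1 (x ^+ r *: (P *m v)).
    rewrite Pv scaler_sumr; apply: (submodule_sum _ S1) => j _.
    by rewrite scalerA mulrC -scalerA; apply: (submoduleZ _ S1); case: (pP j).
  have M2Pv : M2 (x ^+ r *: (v - P *m v)).
    rewrite Pv {1}[v]dsum -sumrB scaler_sumr; apply: (submodule_sum _ S2) => j _.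
    rewrite -scalerBr scalerA mulrC -scalerA; apply: (submoduleZ _ S2).
    by rewrite scalerBr; case: (pP j).
  apply/eqP; rewrite eq_sym -subr_eq0; apply/eqP/scale0.
  apply: (direct _ (x ^+ r *: u2 - x ^+ r *: (v - P *m v))).
  - by rewrite scalerBr; apply: (submoduleB S1) => //; apply: submoduleZ.
  - by apply: (submoduleB S2) => //; apply: submoduleZ.
  rewrite -scalerBr -scalerDr; have -> : u1 - P *m v + (u2 - (v - P *m v)) = 0.
    by rewrite opprB addrA [u1 - _ + _]addrAC subrKA subrr.
  by rewrite scaler0.
have proj1 u : M1 u -> P *m u = u.
  by move=> M1u; rewrite -{1}[u]addr0; apply: proj => //; apply: submodule0.
have PM v : M v -> M (P *m v).
  move=> /Msum[u1 [u2 [M1u M2u ->]]]; rewrite proj // ME; exists u1 => //.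
  by exists 0; [exact: submodule0 | rewrite addr0].
have PP : P *m P = P.
  apply/matrixP => k j; have : P *m p j = p j.
    apply/eqP; rewrite -subr_eq0; apply/eqP/scale0.
    by rewrite scalerBr scalemxAr proj1 ?subrr //; case: (pP j).
  move/matrixP/(_ k ord0); rewrite !mxE => E; rewrite -[RHS]E.
  by apply: eq_bigr => l _; rewrite !mxE.
have [P0|P1] := idempotent_endo PM PP; [left|right].
  apply/seteqP; split=> [u M1u|_ ->]; last exact: submodule0.
  by rewrite /= -(proj1 u M1u) P0 mul0mx.
apply/seteqP; split=> [u M2u|_ ->]; last exact: submodule0.
have := proj 0 u (submodule0 S1) M2u; rewrite add0r P1 mul1mx; exact.
Qed.

End Indecomposable.

(** * The Fitting ideal *)

Section Bidual.
Variables (R : idomainType) (m : set R) (x y : R).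
Hypothesis hR : regular_local2 m x y.
Variables (e i j : nat) (M : set 'cV[R]_e).
Hypothesis Mm : submodule M.
Hypotheses (Mx : forall v, M (x ^+ i *: v)) (My : forall v, M (y ^+ j *: v)).
Implicit Types (phi : 'cV[R]_e -> R^o) (u v w : 'cV[R]_e).

Local Notation M1 := (dual_module M).
Local Notation M2 := (dual_module (dual_module M)).

Let x0 : x ^+ i != 0. Proof. by rewrite expf_neq0 ?(param_neq0 hR). Qed.

Definition dot (c : 'I_e -> R) v : R := \sum_k c k * v k ord0.

Let dotl c a u v : dot c (a *: u + v) = a * dot c u + dot c v.
Proof.
by rewrite /dot mulr_sumr -big_split; apply: eq_bigr => k _; rewrite /= !mxE; ring.
Qed.

Let unit_vec k : 'cV[R]_e := delta_mx k ord0.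

Let vec_sum v : v = \sum_k v k ord0 *: unit_vec k.
Proof. by rewrite {1}[v]matrix_sum_delta; apply: eq_bigr => k _; rewrite big_ord1. Qed.

Lemma dual_sum (V : lmodType R) (A : set V) (phi : V -> R^o) n (c : 'I_n -> R) (u : 'I_n -> V) :
  submodule A -> dual_module A phi -> (forall k, A (u k)) ->
  phi (\sum_k c k *: u k) = \sum_k c k * phi (u k).
Proof.
move=> Am [philin _] Au.
have phi0 : phi 0 = 0.
  have := philin 1 0 0 (submodule0 Am) (submodule0 Am).
  by rewrite scale1r addr0 scale1r => /eqP; rewrite -subr_eq0 opprD addNKr oppr_eq0 => /eqP.
suff [_ ->] : A (\sum_k c k *: u k) /\ phi (\sum_k c k *: u k) = \sum_k c k * phi (u k) by [].
apply: (big_ind2 (fun s t => A s /\ phi s = t)) => [|u1 c1 u2 c2 [Au1 <-] [Au2 <-]|k _].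
- by split=> //; apply: submodule0.
- split; first exact: submoduleD.
  by rewrite -[u1]scale1r philin // !scale1r.
- split; first exact: submoduleZ.
  by rewrite -[_ *: _]addr0 philin ?phi0 ?addr0 //; apply: submodule0.
Qed.

(** A linear form on [M] extends to [R^e]: its values on [x^i R^e] are
    multiples of [x^i], because [x^i, y^j] is a regular sequence. *)
Lemma dual_extend phi : M1 phi -> exists c, forall v, M v -> phi v = dot c v.
Proof.
move=> phiM; have [philin _] := phiM.
have phiZ a v : M v -> phi (a *: v) = a * phi v.
  move=> Mv; have := dual_sum (fun=> a) Mm phiM (u := fun _ : 'I_1 => v) (fun=> Mv).
  by rewrite !big_ord1.
have /choice[c cE] k : exists c, phi (x ^+ i *: unit_vec k) = c * x ^+ i.
  apply: (@regular_seq_pow _ _ _ _ hR i j _ (phi (y ^+ j *: unit_vec k))).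
  by rewrite -phiZ // mulrC -phiZ // !scalerA mulrC.
exists c => v Mv; apply: (mulfI x0).
rewrite -phiZ // {1}[v]vec_sum scaler_sumr.
transitivity (phi (\sum_k v k ord0 *: (x ^+ i *: unit_vec k))).
  by congr phi; apply: eq_bigr => k _; rewrite !scalerA mulrC.
rewrite (dual_sum _ Mm phiM) // /dot mulr_sumr; apply: eq_bigr => k _.
by rewrite cE; ring.
Qed.

Definition coord_form k : 'cV[R]_e -> R^o := fun v => if `[< M v >] then v k ord0 else 0.

Lemma coord_form_dual k : M1 (coord_form k).
Proof.
split=> [a u v Mu Mv|v Mv]; last by rewrite /coord_form; case: asboolP.
have Muv : M (a *: u + v) by apply: submoduleD => //; apply: submoduleZ.
by rewrite /coord_form !asboolT // !mxE.
Qed.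

Lemma dual_submodule (V : lmodType R) (A : set V) : submodule (dual_module A : set (V -> R^o)).
Proof.
apply/submoduleP; split; first by split=> // a u v _ _; rewrite /= scaler0 addr0.
move=> c phi psi [phil phi0] [psil psi0]; split=> [a u v Au Av|v Av].
  change (c *: phi (a *: u + v) + psi (a *: u + v) =
    a *: (c *: phi u + psi u) + (c *: phi v + psi v)).
  by rewrite phil // psil // !scalerDr !scalerA mulrC addrACA.
change (c *: phi v + psi v = 0); by rewrite phi0 // psi0 // scaler0 addr0.
Qed.

(** The element [v] of [R^e] as a functional on the dual of [M], given by the
    extension of a linear form of [M] to [R^e]. *)
Lemma bidual_eval : exists ev : 'cV[R]_e -> ('cV[R]_e -> R^o) -> R^o,
  [/\ forall v, M2 (ev v), forall f, M2 f -> exists v, f = ev v,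
      forall c u v, ev (c *: u + v) = c *: ev u + ev v,
      forall v, M v -> bidual_map M v = ev v
    & forall u v, ev u = ev v -> u = v].
Proof.
have /choice[rep repP] phi : exists c, M1 phi -> forall v, M v -> phi v = dot c v.
  have [/dual_extend[c cE]|nphi] := pselect (M1 phi); first by exists c.
  by exists (fun=> 0) => /nphi.
pose ev v phi : R^o := if `[< M1 phi >] then dot (rep phi) v else 0.
have evE v phi : M1 phi -> x ^+ i * ev v phi = phi (x ^+ i *: v).
  move=> phiM; rewrite (repP phi phiM) // /ev asboolT // /dot mulr_sumr.
  by apply: eq_bigr => k _; rewrite mxE; ring.
have evl c u v : ev (c *: u + v) = c *: ev u + ev v.
  apply/funext => phi; change (ev (c *: u + v) phi = c * ev u phi + ev v phi).
  by rewrite /ev; case: asboolP => _; [exact: dotl | rewrite mulr0 addr0].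
exists ev; split=> //.
- move=> v; split=> [a phi psi phiM psiM|phi nphi]; last by rewrite /ev asboolF.
  have sM : M1 (a *: phi + psi).
    have S := dual_submodule M.
    by apply: (submoduleD S) => //; apply: (submoduleZ _ S).
  apply: (mulfI x0); rewrite evE //.
  change (a * phi (x ^+ i *: v) + psi (x ^+ i *: v) = x ^+ i * (a * ev v phi + ev v psi)).
  by rewrite -!evE //; ring.
- move=> f fM2; exists (\col_k f (coord_form k)).
  apply/funext => phi; rewrite /ev; case: asboolP => phiM; last first.
    by case: fM2 => _; apply.
  have phiE : phi = \sum_k rep phi k *: coord_form k.
    apply/funext => v; rewrite fct_sumE; have [Mv|Mv] := pselect (M v).
      rewrite (repP phi phiM v Mv); apply: eq_bigr => k _.
      by change (rep phi k * v k ord0 = rep phi k * coord_form k v); rewrite /coord_form asboolT.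
    case: phiM => _ -> //; rewrite big1 // => k _.
    by change (rep phi k * coord_form k v = 0); rewrite /coord_form asboolF // mulr0.
  rewrite {1}phiE (dual_sum _ (dual_submodule M) fM2); last exact: coord_form_dual.
  by apply: eq_bigr => k _; rewrite mxE.
- move=> v Mv; apply/funext => phi; rewrite /bidual_map /ev.
  have -> : (phi \in M1) = `[< M1 phi >] by apply/idP/asboolP; rewrite inE.
  by case: asboolP => // phiM; exact: repP.
- move=> u v uv; apply/matrixP => k l; rewrite ord1; apply: (mulfI x0).
  have vk w : x ^+ i * w k ord0 = x ^+ i * ev w (coord_form k).
    by rewrite evE; [rewrite /coord_form asboolT // mxE | exact: coord_form_dual].
  by rewrite !vk uv.
Qed.

End Bidual.

Section Fitting.
Variables (R : idomainType) (m : set R) (x y : R).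
Hypothesis hR : regular_local2 m x y.
Variables (q r p : nat).
Hypotheses (r_gt0 : (0 < r)%N) (rq : (r < q)%N) (pr : (p < r)%N).
Local Notation I := (wt x y q r (q * r)).
Local Notation M := (@wt_module R x y q r p.+1).

Let q_gt0 : (0 < q)%N. Proof. exact: ltn_trans rq. Qed.

(** A monomial in [I] has degree at least [r], hence is a multiple of one of the
    coefficients of [minor_form]. *)
Lemma minor_form_surj z : I z -> exists w : 'cV[R]_p.+1, minor_form x y w = z.
Proof.
suff : I `<=` [set z | exists w : 'cV[R]_p.+1, minor_form x y w = z] by apply.
apply: mono_sub => [|i j ij].
  apply/idealP; split; first by exists 0; exact: minor_form0.
  by move=> c _ _ [u <-] [v <-]; exists (c *: u + v); exact: minor_form_lin.
have pij : (p <= i + j)%N by nia.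
pose k := minn j p.
exists (((-1) ^+ k * x ^+ (i - (p - k)) * y ^+ (j - k)) *: eps R p.+1 k.+1).
rewrite minor_formZ minor_form_eps; last by rewrite ltnS geq_minr.
have -> : x ^+ i = x ^+ (i - (p - k)) * x ^+ (p - k) by rewrite -exprD subnK //; lia.
have -> : y ^+ j = y ^+ (j - k) * y ^+ k by rewrite -exprD subnK //; lia.
rewrite /minor_coef /= [(- y) ^+ _]exprNn.
transitivity ((-1) ^+ k * (-1) ^+ k *
  (x ^+ (i - (p - k)) * x ^+ (p - k) * (y ^+ (j - k) * y ^+ k))).
  by ring.
by rewrite -exprMn mulrNN mulr1 expr1n mul1r.
Qed.

(** The determinant of the [g_i] together with one more vector [w] is the value
    of [minor_form] at [w]: both sides agree after multiplication by [x^p], the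
    minor of the [g_i] without the first coordinate. *)
Lemma minor_form_det (w : 'cV[R]_p.+1) :
  \det (\matrix_(i < p.+1, j < p.+1)
    (if (i == 0%N :> nat) then w j ord0 else koszul_rel x y p.+1 i j ord0)) = minor_form x y w.
Proof.
set A := \matrix_(i, j) _.
pose phi : 'cV[R]_p.+1 := \col_k minor_coef x y p.+1 k.
have Aphi : A *m phi = minor_form x y w *: delta_mx ord0 ord0.
  apply/matrixP => i j; rewrite ord1 !mxE eqxx andbT.
  have [i0|i0] := posnP i.
    have -> : (i == ord0) by apply/eqP/val_inj.
    by rewrite mulr1; apply: eq_bigr => k _; rewrite !mxE i0 mulrC.
  have -> : (i == ord0) = false by apply/eqP => i0'; move: i0; rewrite i0'.
  rewrite mulr0; transitivity (minor_form x y (koszul_rel x y p.+1 i)).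
    apply: eq_bigr => k _; rewrite !mxE (gtn_eqF i0).
    by rewrite mulrC.
  by rewrite minor_form_koszul_rel // i0 ltn_ord.
have cof : cofactor A ord0 ord0 = x ^+ p.
  rewrite /cofactor mul1r det_trig; last first.
    apply/is_trig_mxP => i j ij; rewrite !mxE /= !eqSS /bump /=.
    rewrite (gtn_eqF ij) (_ : ((1 + j)%N == i) = false) ?mulr0 ?addr0 //.
    by apply/eqP => ji; move: ij; rewrite -ji; lia.
  rewrite -[in RHS](card_ord p) -prodr_const; apply: eq_bigr => i _.
  rewrite !mxE /= !eqSS /bump /= eqxx mulr1 (_ : ((1 + i)%N == i) = false) ?mulr0 ?add0r //.
  by apply/eqP; lia.
have x0 : x ^+ p != 0 by rewrite expf_neq0 ?(param_neq0 hR).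
apply: (mulIf x0).
have := congr1 (mulmx (\adj A)) Aphi; rewrite mulmxA mul_adj_mx -scalemxAr mul_scalar_mx.
move/matrixP/(_ ord0 ord0); rewrite mxE [phi _ _]mxE /minor_coef /= mul1r subn0 => ->.
by rewrite mxE -colE !mxE cof.
Qed.

(** The coordinates of a vector [v] of [M] are in [m]: compare the coefficients of
    the linear forms in [y v], which is in [M]. *)
Lemma wt_module_coord (v : 'cV[R]_p.+1) k : M v -> wt x y q r r (v k ord0).
Proof.
move=> Mv; have : m (v k ord0).
  have kp : (k <= p)%N by rewrite -ltnS.
  have : M (y *: v + x *: 0).
    rewrite scaler0 addr0 /wt_module /= minor_formZ.
    exact: idealM (wt_ideal _ _ _ _ _) Mv.
  move/(linear_part_coef hR rq pr kp); rewrite inord_val mxE.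
  by case: ifP => _; rewrite subr0.
move=> /(lmaxP hR)[s [t ->]]; have Wi := wt_ideal x y q r r.
apply: (idealD Wi); apply: (idealM _ Wi).
  suff : wt x y q r r (x ^+ 1 * y ^+ 0) by rewrite expr0 mulr1.
  by apply: wt_monomial; lia.
suff : wt x y q r r (x ^+ 0 * y ^+ 1) by rewrite expr0 mul1r.
by apply: wt_monomial; lia.
Qed.

Lemma wt_prod n (F : nat -> R) : (forall i, (i < n)%N -> wt x y q r r (F i)) ->
  wt x y q r (n * r) (\prod_(i < n) F i).
Proof.
elim: n => [|n IHn] Fw; first by rewrite big_ord0; exact: wt0.
rewrite big_ord_recr mulSn addnC /=; apply: wt_mul; last exact: Fw.
by apply: IHn => i i_n; apply: Fw; apply: ltnW.
Qed.

(** The order is additive and that of [y^k] is [r * k]. *)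
Lemma wt_cancel_y n k z : wt x y q r (n + r * k) (y ^+ k * z) -> wt x y q r n z.
Proof.
move=> yz; apply: contrapT => nz.
have [[|j] [jz jmin]] := ex_least (ex_intro (fun j => ~ wt x y q r j z) n nz).
  by case: jz; exact: wt0.
have jz' : wt x y q r j z by apply: contrapT => /jmin; rewrite ltnn.
have jn : (j < n)%N by exact: jmin.
have yk : y ^+ k = x ^+ 0 * y ^+ k by rewrite mul1r.
have := @wt_mul_exact _ _ _ _ hR q r q_gt0 r_gt0 (r * k) j (y ^+ k) z; apply => //.
- by rewrite yk; apply: wt_monomial; rewrite leq_addl.
- by rewrite yk => /(mono_monomial hR)[i [l [+ i0 lk]]]; nia.
by apply: wt_anti yz; lia.
Qed.

(** Fitting's argument. Appending to the relations [A] on the generators [Q] the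
    expressions [C] of the standard basis gives a square matrix of relations with
    the same determinant, and column operations turn its last [p + 1] columns
    into vectors of [M]. Replacing moreover the last coordinate of these vectors
    by the value of [minor_form] multiplies the determinant by [y^p], up to
    sign; then one column has entries in [I] and [p] others have entries in
    [m], so the value of the determinant is at least [q * r + p * r]. *)
Lemma relation_det n (A : 'M[R]_n) (Q : 'M[R]_(n, p.+1)) (C : 'M[R]_(p.+1, n)) :
  (forall i, M (row i (A *m Q))^T) -> (forall k, M (row k (1%:M - C *m Q))^T) ->
  I (\det A).
Proof.
move=> MA MC.
pose U : 'M[R]_p.+1 :=
  \matrix_(k, l) if l == ord_max then minor_coef x y p.+1 k else (k == l)%:R.
have detU : \det U = (- y) ^+ p.
  rewrite -det_tr det_trig.
    rewrite (bigD1 ord_max) //= big1 ?mulr1 => [|k /negPf kmax]; rewrite !mxE.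
      by rewrite eqxx /minor_coef subnn mulr1.
    by rewrite kmax eqxx.
  apply/is_trig_mxP => k l kl; rewrite !mxE.
  have -> : (k == ord_max) = false.
    by apply/eqP => kmax; move: kl; rewrite kmax /= ltnNge -ltnS ltn_ord.
  by rewrite (_ : (l == k) = false) //; apply/eqP => lk; move: kl; rewrite lk ltnn.
pose D : 'M[R]_(n + p.+1, p.+1) := col_mx (A *m Q) (1%:M - C *m Q).
have DM i : M (row i D)^T.
  by case: (split_ordP i) => k ->; rewrite ?rowKu ?rowKd.
have DUr i (l : 'I_p.+1) : (l < p)%N -> wt x y q r r ((D *m U) i l).
  move=> lp; have lmax : (l == ord_max) = false.
    by apply/eqP => E; move: lp; rewrite E ltnn.
  have -> : (D *m U) i l = (row i D)^T l ord0.
    rewrite mxE (bigD1 l) //= big1 ?addr0 => [|k /negPf kl]; rewrite !mxE.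
      by rewrite eqxx lmax mulr1.
    by rewrite kl lmax mulr0.
  exact: wt_module_coord.
have DUq i : I ((D *m U) i ord_max).
  suff -> : (D *m U) i ord_max = minor_form x y (row i D)^T by exact: DM.
  by rewrite mxE; apply: eq_bigr => k _; rewrite !mxE eqxx mulrC.
pose B := block_mx A (A *m Q *m U) (- C) ((1%:M - C *m Q) *m U).
have detB : \det B = (-1) ^+ p * (y ^+ p * \det A).
  have -> : B = block_mx A 0 (- C) 1%:M *m block_mx 1%:M (Q *m U) 0 U.
    rewrite mulmx_block !mulmx1 !mul0mx !mulmx0 !addr0 mul1mx mulmxA.
    by rewrite /B mulmxBl mul1mx mulNmx addrC mulmxA.
  by rewrite det_mulmx det_lblock det_ublock !det1 detU [(- y) ^+ _]exprNn; ring.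
have BE i l : B i (rshift n l) = (D *m U) i l.
  by rewrite /B block_mxEh row_mxEr /D mul_col_mx.
suff IB : wt x y q r (q * r + r * p) (\det B).
  apply: (@wt_cancel_y _ p); rewrite -[_ * _]mul1r -[1](expr1n _ p) -[1]mulr1 -[1 * 1]mulrNN.
  rewrite exprMn -mulrA -detB; exact: (idealM _ (wt_ideal _ _ _ _ _) IB).
have Wi := wt_ideal x y q r (q * r + r * p).
rewrite -det_tr; apply: (ideal_sum _ Wi) => s _; apply: (idealM _ Wi).
rewrite big_split_ord /=; apply: (idealM _ Wi).
rewrite big_ord_recr /= addnC [(r * p)%N]mulnC; apply: wt_mul; last by rewrite mxE BE.
pose F l := B (s (rshift n (inord l : 'I_p.+1))) (rshift n (inord l)).
rewrite (eq_bigr (fun l : 'I_p => F l)); last first.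
  move=> l _; rewrite mxE /F.
  have -> // : inord l = widen_ord (leqnSn p) l.
  by apply: val_inj; rewrite /= inordK // ltnW // ltnS.
by apply: wt_prod => l lp; rewrite /F BE; apply: DUr; rewrite inordK // ltnW // ltnS.
Qed.

(** The Fitting ideal contains [I] by the relations [w, g_1, .., g_p] on the
    standard basis, and [relation_det] bounds it for any choice of generators. *)
Lemma wt_module_fitting : fitting_ideal M = I.
Proof.
have Mm : submodule M := wt_module_submodule x y q r p.+1.
have [ev [evM2 evsurj evl evM evinj]] := bidual_eval hR Mm
  (fun v => wt_module_scale v (@wt_x R x y q r)) (fun v => wt_module_scale v (@wt_y R x y q r)).
have ev0 : ev 0 = 0.
  by have := evl (-1) 0 0; rewrite scaler0 addr0 scaleN1r addNr.
have evD u v : ev (u + v) = ev u + ev v by rewrite -{1}[u]scale1r evl scale1r.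
have evZ c u : ev (c *: u) = c *: ev u by rewrite -[c *: u]addr0 evl ev0 addr0.
have evsum n (c : 'I_n -> R) (Q : 'I_n -> 'cV[R]_p.+1) :
    ev (\sum_k c k *: Q k) = \sum_k c k *: ev (Q k).
  by rewrite (big_morph ev evD ev0); apply: eq_bigr => k _; rewrite evZ.
have imP v : (bidual_map M @` M) (ev v) <-> M v.
  split=> [[u Mu]|Mv]; last by exists v => //; exact: evM.
  by rewrite evM // => /evinj <-.
apply/seteqP; split=> [z [n [f [fM2 fgen zdet]]]|z Iz].
  have /choice[Q QE] k : exists v, f k = ev v by exact: evsurj.
  have /choice[C CE] k : exists c : 'I_n -> R, M (delta_mx k ord0 - \sum_i c i *: Q i).
    have [c cE] := fgen (ev (delta_mx k ord0)) (evM2 _); exists c; apply/imP.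
    rewrite evD -scaleN1r evZ scaleN1r evsum.
    by under eq_bigr do rewrite -QE.
  move: z zdet; apply: ideal_gen_sub; first exact: wt_ideal.
  move=> _ [A AE <-].
  apply: (@relation_det _ A (\matrix_(i, k) Q i k ord0) (\matrix_(k, i) C k i)).
    move=> i; have := AE i; under eq_bigr do rewrite QE.
    rewrite -evsum => /imP; congr M; apply/matrixP => k l; rewrite ord1 !mxE summxE.
    by apply: eq_bigr => j _; rewrite !mxE.
  move=> k; have := CE k; congr M; apply/matrixP => j l; rewrite [l]ord1 !mxE summxE eqxx andbT.
  rewrite eq_sym; congr (_ - _).
  by apply: eq_bigr => i _; rewrite !mxE.
have [w wE] := minor_form_surj Iz.
exists p.+1, (fun k => ev (delta_mx k ord0)); split=> [k|f fM2|].
- exact: evM2.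
- have [v ->] := evsurj f fM2; exists (fun k => v k ord0).
  rewrite -evsum (_ : \sum_k _ = v); last first.
    by rewrite [RHS]matrix_sum_delta; apply: eq_bigr => j _; rewrite big_ord1.
  by rewrite subrr -ev0; apply/imP; exact: submodule0.
apply: ideal_gen_gen; rewrite -wE -minor_form_det; set A := \matrix_(i, j) _.
exists A => // i; rewrite -evsum; apply/imP.
have -> : \sum_j A i j *: delta_mx j ord0 =
    if i == 0%N :> nat then w else koszul_rel x y p.+1 i.
  apply/matrixP => k l; rewrite [l]ord1 summxE (bigD1 k) //= !mxE !eqxx /= mulr1n mulr1 big1 ?addr0.
    by case: ifP => _; rewrite // !mxE.
  by move=> j /negPf jk; rewrite !mxE [k == j]eq_sym jk mulr0.
have [_|i0] := posnP i; first by rewrite /wt_module /= wE.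
by apply: wt_module_koszul_rel; rewrite i0 ltn_ord.
Qed.

End Fitting.

Theorem corollary6p4 (R : idomainType) (m : set R) (x y : R)
    (hR : regular_local2 m x y) (hk : infinite_residue_field m)
    (I : set R) (r : nat) (hr : (2 <= r)%N)
    (hsimple : simple_ideal I) (hcomplete : complete_ideal I)
    (hord : ideal_order m I r)
    (a b : nat -> nat)
    (hI : I = ideal_gen [set x ^+ a i * y ^+ b i | i in [set i | (i <= r)%N]])
    (ha : forall i, (i < r)%N -> (a i.+1 < a i)%N) (har : a r = 0%N)
    (hb0 : b 0%N = 0%N) (hb : forall i, (i < r)%N -> (b i < b i.+1)%N)
    (hab : (a 0%N <= b r)%N)
    (e : nat) (he : (2 <= e <= r)%N) :
  let M : set 'cV[R]_e := assoc_module x y r a b e in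
  [/\ indecomposable M, integrally_closed M, module_rank M e
    & fitting_ideal M = I].
Proof.
move=> M.
have aE := staircase_a hR hr hsimple hcomplete hord hI ha har hb0 hb hab.
have IE := staircase_wt hR hr hsimple hcomplete hord hI ha har hb0 hb hab.
have cop := staircase_coprime hR hr hsimple hcomplete hord hI ha har hb0 hb hab.
have rq := staircase_q hR hr hsimple hcomplete hord hI ha har hb0 hb hab.
have r_gt0 : (0 < r)%N by lia.
have ME : M = @wt_module R x y (b r) r e.
  rewrite /M (assoc_moduleE hR _ _ hI aE (staircase_b_ge hb0 hb)); [|lia|lia].
  by rewrite {1}IE.
rewrite ME; case: e he {M ME} => // p /andP[_ pr].
split.
- exact: (wt_module_indecomposable hR rq pr).
- exact: (wt_module_integrally_closed hR _ r_gt0 rq cop).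
- exact: (wt_module_rank hR).
- by rewrite IE (wt_module_fitting hR r_gt0 rq pr).
Qed.
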